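(* Let $\mathcal{A}$ be a unital $C^*$-algebra and let $F \in B^a(H_{\mathcal{A}})$. The following statements are equivalent: (1) $F \in \mathcal{M}\Phi_+(H_{\mathcal{A}})$, i.e. $F$ is an upper semi-$\mathcal{A}$-Fredholm operator; (2) there exist $D \in B^a(H_{\mathcal{A}})$ and $K \in K(H_{\mathcal{A}})$ such that $DF = I + K$.
   Context: $\mathcal{A}$ is a unital $C^*$-algebra; $H_{\mathcal{A}} = \ell^2(\mathcal{A})$ is the standard Hilbert $\mathcal{A}$-module of sequences $(a_i)$ in $\mathcal{A}$ with $\sum_i a_i^* a_i$ norm convergent. $B^a(H_{\mathcal{A}})$ is the $C^*$-algebra of bounded adjointable $\mathcal{A}$-linear operators on $H_{\mathcal{A}}$, and $K(H_{\mathcal{A}})$ is its closed two-sided ideal of compact operators (the norm closure of the linear span of the operators $z \mapsto x\langle y, z\rangle$). $M \tilde\oplus N$ denotes a direct sum of closed submodules that is not necessarily orthogonal ($M\cap N=\{0\}$ and $M+N$ is the whole space). A Hilbert module is finitely generated if it is the (algebraic) $\mathcal{A}$-linear span of a finite set. An isomorphism of Hilbert modules is a bounded $\mathcal{A}$-linear bijection (with bounded inverse). $F \in B^a(H_{\mathcal{A}})$ is upper semi-$\mathcal{A}$-Fredholm, written $F \in \mathcal{M}\Phi_+(H_{\mathcal{A}})$, if there are closed submodules $M_1, N_1, M_2, N_2$ of $H_{\mathcal{A}}$ with $H_{\mathcal{A}} = M_1 \tilde\oplus N_1 = M_2 \tilde\oplus N_2$, with $F(M_1) \subseteq M_2$,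 $F(N_1) \subseteq N_2$ (so $F$ has a diagonal matrix with entries $F_1,F_4$ as a map $M_1 \tilde\oplus N_1 \to M_2 \tilde\oplus N_2$), $F_1 = F|_{M_1}: M_1 \to M_2$ an isomorphism, and $N_1$ finitely generated. *)

(* Defs.v *)
From HB Require Import structures.
From mathcomp Require Import all_boot all_order all_algebra.
From mathcomp Require Import complex.
From mathcomp Require Import all_classical all_reals all_analysis.

Set Implicit Arguments.
Unset Strict Implicit.
Unset Printing Implicit Defensive.

Import Order.TTheory GRing.Theory Num.Theory.
Import numFieldNormedType.Exports.

Local Open Scope classical_set_scope.
Local Open Scope ring_scope.
Local Open Scope complex_scope.

(* Multiplication is a field on top of [completeNormedModType], rather than a
   ring structure: HB already takes [numDomainType] to be the join of rings and
   normed modules, so no type can canonically be a ring and a normed module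
   otherwise.  As 1 != 0 is not required, the zero algebra is allowed. *)
HB.mixin Record isCStarAlgebra (R : realType) A
    & CompleteNormedModule R[i] A := {
  cmul : A -> A -> A ;
  cone : A ;
  cstar : A -> A ;
  cmulA : associative cmul ;
  cmul1l : left_id cone cmul ;
  cmul1r : right_id cone cmul ;
  cmulDl : left_distributive cmul +%R ;
  cmulDr : right_distributive cmul +%R ;
  cmulZl : forall (c : R[i]) (a b : A), cmul (c *: a) b = c *: cmul a b ;
  cmulZr : forall (c : R[i]) (a b : A), cmul a (c *: b) = c *: cmul a b ;
  cnormM_le : forall a b : A, `|cmul a b| <= `|a| * `|b| ;
  cstarD : forall a b : A, cstar (a + b) = cstar a + cstar b ;
  cstarZ : forall (c : R[i]) (a : A), cstar (c *: a) = Num.conj c *: cstar a ;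
  cstarM : forall a b : A, cstar (cmul a b) = cmul (cstar b) (cstar a) ;
  cstarK : involutive cstar ;
  cstar_norm : forall a : A, `|cmul (cstar a) a| = `|a| ^+ 2
}.

#[short(type="cstarAlgType")]
HB.structure Definition CStarAlgebra (R : realType) :=
  {A of isCStarAlgebra R A & CompleteNormedModule R[i] A}.

Local Notation "a *c b" := (cmul a b) (at level 40, left associativity).

(* H_A is a set of sequences inside the (pointwise) group nat -> A, so an
   operator on H_A is a function on all sequences of which only the values on
   H_A are ever used. *)
Section StandardHilbertModule.
Context {R : realType} {A : cstarAlgType R}.
Implicit Types (x y z : nat -> A) (M N : set (nat -> A)).
Implicit Types (T S : (nat -> A) -> (nat -> A)).

Definition HA : set (nat -> A) :=
  [set x | cvgn (series (fun i => cstar (x i) *c x i))].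

Definition rscale x (a : A) : nat -> A := fun i => x i *c a.

Definition hinner x y : A := limn (series (fun i => cstar (x i) *c y i)).

Definition hnorm x : R[i] := sqrtC `|hinner x x|.

Definition Alinear_on M T : Prop :=
  forall x y (a : A), M x -> M y -> T (rscale x a + y) = rscale (T x) a + T y.

Definition opnorm_le M T (c : R[i]) : Prop :=
  forall x, M x -> hnorm (T x) <= c * hnorm x.

Definition bounded_on M T : Prop := exists c : R[i], opnorm_le M T c.

Definition adjoint T S : Prop :=
  set_fun HA HA S /\
  forall x y, HA x -> HA y -> hinner (T x) y = hinner x (S y).

Definition Ba T : Prop :=
  [/\ set_fun HA HA T, Alinear_on HA T, bounded_on HA T
    & exists S, adjoint T S].

Definition theta x y : (nat -> A) -> (nat -> A) :=
  fun z => rscale x (hinner y z).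

Definition finite_rank S : Prop :=
  exists (n : nat) (c : 'I_n -> R[i]) (x y : 'I_n -> nat -> A),
    (forall i, HA (x i) /\ HA (y i)) /\
    forall z, HA z -> S z = \sum_(i < n) c i *: theta (x i) (y i) z.

Definition compact_op T : Prop :=
  Ba T /\ forall e : R[i], 0 < e ->
    exists2 S, finite_rank S & opnorm_le HA (fun z => T z - S z) e.

Definition hclosed M : Prop :=
  forall x, HA x ->
    (forall e : R[i], 0 < e -> exists2 y, M y & hnorm (x - y) < e) -> M x.

Definition closed_submodule M : Prop :=
  [/\ M `<=` HA, M 0, (forall x y, M x -> M y -> M (x + y)),
      (forall x (a : A), M x -> M (rscale x a)) & hclosed M].

Definition direct_sum M N : Prop :=
  [/\ closed_submodule M, closed_submodule N, M `&` N = [set 0]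
    & [set x + y | x in M & y in N] = HA].

Definition finitely_generated N : Prop :=
  exists (n : nat) (g : 'I_n -> nat -> A),
    N = [set x | exists a : 'I_n -> A, x = \sum_(i < n) rscale (g i) (a i)].

Definition module_iso M N T : Prop :=
  [/\ Alinear_on M T, bounded_on M T, set_bij M N T
    & exists2 S, (forall x, M x -> S (T x) = x) & bounded_on N S].

Definition upper_semi_Fredholm (F : (nat -> A) -> (nat -> A)) : Prop :=
  Ba F /\
  exists M1 N1 M2 N2 : set (nat -> A),
    [/\ direct_sum M1 N1 /\ direct_sum M2 N2,
        set_fun M1 M2 F, set_fun N1 N2 F, module_iso M1 M2 F
      & finitely_generated N1].

End StandardHilbertModule.

(* Main.v *)
Require Import Defs.
From HB Require Import structures.
From mathcomp Require Import all_boot all_order all_algebra.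
From mathcomp Require Import complex.
From mathcomp Require Import all_classical all_reals all_analysis.
From mathcomp Require Import ring lra.

(** A Fredholm decomposition gives a left inverse modulo compacts as follows.  Let
    [g 1 .. g n] generate [N1], and let [S] be [F^* F] plus the sum of the rank one
    operators [theta (g i) (g i)].  If [S] is invertible, then [D = S^-1 F^*] satisfies
    [D F = 1 - S^-1 (gram g)], where the correction even has finite rank
    ([left_inverse_of_Fredholm]).  Invertibility holds because [x] is controlled by [F x]
    together with its inner products with the [g i] ([Fredholm_lower_bound]): the first
    term sees the component of [x] in [M1], since the projection onto [M2] along [N2] is
    bounded, and the inner products see the component in [N1].  Both facts come from one
    open mapping theorem, [sum_ball_open].  The lower bound persists for [S + l] with
    [l >= 0], so the continuity method [surjective_of_lower_bound] descends from large [l]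
    to [l = 0].

    Conversely, let [D F = 1 + K].  A compact operator is small on sequences that vanish
    before a large [n] ([compact_tail_small]), so on those sequences [D F] agrees with an
    invertible operator [W].  The operator [V = (tail n) W^-1 D] satisfies [V F V = V], and the
    ranges and kernels of the idempotents [V F] and [F V] form the two decompositions.
    The kernel of [V F] is generated by the images of the first [n] unit sequences.

    The analysis rests on the Cauchy-Schwarz inequality for finite sums,
    [fip_cauchy_schwarz], and thus on the positivity of [star x * x], which is proved here
    without spectral theory.  A self-adjoint [p] is called positive if [t - p] has norm at
    most [t] for some real [t].  Square roots come from a contraction; unitaries of the form
    [r + i (1 - r^2)^(1/2)] show that squares are positive; and comparing the growth of the
    powers of [1 - t b (star b)] and [1 - t (star b) b] transfers positivity from [b (star b)]
    to [(star b) b] ([pos_swap]), which is what Kaplansky's argument needs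
    ([pos_star_mul]). *)

Set Implicit Arguments.
Unset Strict Implicit.
Unset Printing Implicit Defensive.

Import Order.TTheory GRing.Theory Num.Theory.
Import numFieldNormedType.Exports.

Local Open Scope classical_set_scope.
Local Open Scope ring_scope.
Local Open Scope complex_scope.

(** * The ring underlying the algebra, and its norm *)

(** An alias of the algebra that carries a genuine ring structure and real scalars,
    so that the ring and module lemmas apply to the algebra operations. *)
Definition cring (R : realType) (A : cstarAlgType R) : Type := A.

Section CRing.
Context {R : realType} {A : cstarAlgType R}.

HB.instance Definition _ := GRing.Zmodule.copy (cring A) A.
HB.instance Definition _ := GRing.Zmodule_isPzRing.Build (cring A)
  (@cmulA R A) (@cmul1l R A) (@cmul1r R A) (@cmulDl R A) (@cmulDr R A).

Definition rscal (r : R) (a : cring A) : cring A := r%:C *: (a : A).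

Lemma rscalA r s a : rscal r (rscal s a) = rscal (r * s) a.
Proof. by rewrite /rscal scalerA rmorphM. Qed.
Lemma rscal1 : left_id 1 rscal.
Proof. by move=> a; rewrite /rscal rmorph1 scale1r. Qed.
Lemma rscalDr : right_distributive rscal +%R.
Proof. by move=> r a b; rewrite /rscal scalerDr. Qed.
Lemma rscalDl a : {morph rscal^~ a : r s / r + s}.
Proof. by move=> r s; rewrite /rscal rmorphD scalerDl. Qed.

HB.instance Definition _ := GRing.Zmodule_isLmodule.Build R (cring A)
  rscalA rscal1 rscalDr rscalDl.

Lemma rscaleAl r (a b : cring A) : r *: a * b = r *: (a * b).
Proof. exact: cmulZl. Qed.

Lemma rscaleAr r (a b : cring A) : a * (r *: b) = r *: (a * b).
Proof. exact: cmulZr. Qed.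

Definition star (a : cring A) : cring A := cstar (a : A).
Definition imul (a : cring A) : cring A := 'i%C *: (a : A).
(** The norm as a real number: the order of [R[i]] is only partial, and real
    arithmetic is wanted throughout. *)
Definition nA (a : cring A) : R := complex.Re `|a : A|.

Lemma nAE (a : A) : `|a| = (nA a)%:C.
Proof. by rewrite /nA RRe_real// normr_real. Qed.

Lemma starD a b : star (a + b) = star a + star b. Proof. exact: cstarD. Qed.
Lemma starM a b : star (a * b) = star b * star a. Proof. exact: cstarM. Qed.
Lemma starK : involutive star. Proof. exact: cstarK. Qed.
Lemma starZ r a : star (r *: a) = r *: star a.
Proof.
rewrite /star {1}/GRing.scale/= /rscal cstarZ conj_Creal//.
by apply/complex_realP; exists r.
Qed.
Lemma star0 : star 0 = 0. Proof. by have := starZ 0 0; rewrite !scale0r. Qed.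
Lemma starN a : star (- a) = - star a.
Proof. by have := starZ (-1) a; rewrite !scaleN1r. Qed.
Lemma starB a b : star (a - b) = star a - star b.
Proof. by rewrite starD starN. Qed.
Lemma star1 : star 1 = 1.
Proof. by rewrite -[LHS]mul1r -[X in X * _](starK 1) -starM mul1r starK. Qed.
Lemma starX a n : star (a ^+ n) = star a ^+ n.
Proof. by elim: n => [|n IH]; rewrite ?expr0 ?star1// exprSr starM IH exprS. Qed.
Lemma star_sum I (r : seq I) (P : pred I) (F : I -> cring A) :
  star (\sum_(i <- r | P i) F i) = \sum_(i <- r | P i) star (F i).
Proof. by apply: (big_morph star starD star0). Qed.

Lemma imulN a : imul (- a) = - imul a. Proof. by rewrite /imul [LHS](@scalerN _ A). Qed.
Lemma imulAl a b : imul a * b = imul (a * b). Proof. exact: cmulZl. Qed.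
Lemma imulAr a b : a * imul b = imul (a * b). Proof. exact: cmulZr. Qed.
Lemma imul2 a : imul (imul a) = - a.
Proof.
by rewrite /imul scalerA (_ : _ * _ = -1) ?scaleN1r// -expr2 sqr_i.
Qed.
Lemma star_imul a : star (imul a) = - imul (star a).
Proof.
rewrite /star /imul cstarZ (_ : Num.conj _ = - 'i%C) ?scaleNr//.
by apply/eqP; rewrite eq_complex/= !eqxx oppr0 eqxx.
Qed.

Lemma nA_ge0 a : 0 <= nA a.
Proof. by rewrite -ler0c -nAE. Qed.
Lemma nAD a b : nA (a + b) <= nA a + nA b.
Proof. by rewrite -lecR rmorphD/= -!nAE ler_normD. Qed.
Lemma nAM a b : nA (a * b) <= nA a * nA b.
Proof. by rewrite -lecR rmorphM/= -!nAE cnormM_le. Qed.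
Lemma nA_cstar a : nA (star a * a) = nA a ^+ 2.
Proof. by apply: complexI; rewrite -nAE rmorphXn/= -nAE cstar_norm. Qed.
Lemma nAZ r a : nA (r *: a) = `|r| * nA a.
Proof.
apply: complexI; rewrite -nAE normrZ rmorphM/= -nAE; congr (_ * _).
by rewrite normc_def/= expr0n/= addr0 sqrtr_sqr.
Qed.
Lemma nA_imul a : nA (imul a) = nA a.
Proof.
apply: complexI; rewrite -!nAE normrZ normc_def/= expr0n/= expr1n add0r sqrtr1.
by rewrite mul1r.
Qed.
Lemma nA0 : nA 0 = 0. Proof. by rewrite -(scale0r 0) nAZ normr0 mul0r. Qed.
Lemma nAN a : nA (- a) = nA a.
Proof. by rewrite -scaleN1r nAZ normrN1 mul1r. Qed.
Lemma nAC a b : nA (a - b) = nA (b - a).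
Proof. by rewrite -nAN opprB. Qed.
Lemma nAB a b : nA (a - b) <= nA a + nA b.
Proof. by rewrite (le_trans (nAD _ _))// nAN. Qed.
Lemma nA_eq0 a : nA a = 0 -> a = 0.
Proof. by move=> a0; apply/(@normr0_eq0 _ A); rewrite nAE a0. Qed.
Lemma nA_le0 a : nA a <= 0 -> a = 0.
Proof. by move=> a0; apply/nA_eq0/le_anti; rewrite a0 nA_ge0. Qed.
Lemma nA_sum I (r : seq I) (P : pred I) (F : I -> cring A) :
  nA (\sum_(i <- r | P i) F i) <= \sum_(i <- r | P i) nA (F i).
Proof.
elim/big_ind2 : _ => [|x c y d xc yd|//]; rewrite ?nA0//.
by rewrite (le_trans (nAD _ _))// lerD.
Qed.

Lemma nA_star a : nA (star a) = nA a.
Proof.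
suff le_star b : nA b <= nA (star b).
  by apply/le_anti; rewrite le_star andbT (le_trans (le_star _))// starK.
have [->|b0] := eqVneq (nA b) 0; first exact: nA_ge0.
have bgt0 : 0 < nA b by rewrite lt0r b0 nA_ge0.
by rewrite -(ler_pM2r bgt0) -expr2 -nA_cstar nAM.
Qed.

Lemma nA1_le1 : nA 1 <= 1.
Proof.
have := nA_cstar 1; rewrite star1 mulr1 => n1.
have := nA_ge0 1; nra.
Qed.

Lemma nAX a n : nA (a ^+ n) <= nA a ^+ n.
Proof.
elim: n => [|n IH]; first exact: nA1_le1.
by rewrite !exprS (le_trans (nAM _ _))// ler_wpM2l ?nA_ge0.
Qed.

Lemma nA_sa_sqr a : star a = a -> nA (a ^+ 2) = nA a ^+ 2.
Proof. by move=> sa; rewrite -nA_cstar sa expr2. Qed.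

Lemma nA_saX2 a m : star a = a -> nA (a ^+ (2 ^ m)) = nA a ^+ (2 ^ m).
Proof.
move=> sa; elim: m => [|m IH]; first by rewrite expn0 !expr1.
by rewrite expnSr !exprM nA_sa_sqr ?IH// starX sa.
Qed.

Definition tends (u : nat -> cring A) (l : cring A) :=
  forall e : R, 0 < e -> exists N, forall n, (N <= n)%N -> nA (l - u n) <= e.

Lemma tendsP (u : nat -> A) (l : A) : u @ \oo --> l <-> tends u l.
Proof.
split=> [/cvgrPdist_le ul e e0|ul].
  have [|N _ Nu] := ul e%:C; first by rewrite ltcR.
  by exists N => n /Nu /=; rewrite nAE lecR.
apply/cvgrPdist_le => e e0.
have [|N Nu] := ul (complex.Re e); first by rewrite -ltcR RRe_real ?gtr0_real.
exists N => // n /= /Nu; rewrite -lecR -nAE RRe_real//; exact: gtr0_real.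
Qed.

Lemma le_of_forall_eps (a b : R) : (forall e, 0 < e -> a <= b + e) -> a <= b.
Proof. by move=> ab; apply/ler_addgt0Pr. Qed.

Lemma tends_nA_le u l a c : tends u l ->
  (exists N, forall n, (N <= n)%N -> nA (u n - a) <= c) -> nA (l - a) <= c.
Proof.
move=> ul [N Nc]; apply: le_of_forall_eps => e /ul [M Mu].
have := Mu _ (leq_maxr N M); have := Nc _ (leq_maxl N M).
set w := u _ => w1 w2; rewrite (_ : l - a = (l - w) + (w - a)); last first.
  by rewrite addrA subrK.
by rewrite (le_trans (nAD _ _))// addrC lerD.
Qed.

Lemma cauchy_tends (u : nat -> cring A) :
  (forall e : R, 0 < e -> exists N, forall k j,
    (N <= k)%N -> (k <= j)%N -> nA (u j - u k) <= e) ->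
  exists l, tends u l.
Proof.
move=> uC; pose v : nat -> A := u.
have : cauchy (v @ \oo).
  apply: cauchy_exP => e e0.
  have re0 : 0 < complex.Re e by rewrite -ltcR RRe_real ?gtr0_real.
  have [|N Nu] := uC (complex.Re e / 2); first by rewrite divr_gt0.
  exists (v N); exists N => // j /= Nj; rewrite /= -ball_normE /ball_/=.
  rewrite -(RRe_real (gtr0_real e0)) nAE ltcR nAC.
  rewrite (le_lt_trans (Nu _ _ (leqnn N) Nj))//.
  by rewrite ltr_pdivrMr// ltr_pMr// ltr1n.
by move/cauchy_cvg/cvg_ex => [/= l /tendsP vl]; exists l.
Qed.

Lemma cring_complete (u : nat -> cring A) (eta : nat -> R) :
  (forall k j, (k <= j)%N -> nA (u j - u k) <= eta k) ->
  (forall e, 0 < e -> exists k, eta k <= e) ->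
  exists2 l, tends u l & forall k, nA (l - u k) <= eta k.
Proof.
move=> uC eta0; have [e e0|l ul] := @cauchy_tends u.
  have [|N Ne] := eta0 (e / 2); first by rewrite divr_gt0.
  exists N => k j Nk kj.
  have -> : u j - u k = (u j - u N) + (u N - u k) by rewrite addrA subrK.
  rewrite (le_trans (nAD _ _))// [X in _ + X]nAC.
  by have := uC _ _ Nk; have := uC _ _ (leq_trans Nk kj); lra.
by exists l => // k; apply: (tends_nA_le ul); exists k => n /uC.
Qed.

Lemma tends_unique u l l' : tends u l -> tends u l' -> l = l'.
Proof.
move=> /tendsP ul /tendsP ul'; exact: (@cvg_unique _ (@norm_hausdorff _ A) _ _ _ _ ul ul').
Qed.

Lemma tendsD u v l m : tends u l -> tends v m -> tends (fun n => u n + v n) (l + m).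
Proof. by move=> /tendsP ul /tendsP vm; apply/tendsP; exact: cvgD. Qed.

Lemma tends_lip u l (f : cring A -> cring A) C : 0 <= C ->
  (forall a b, nA (f a - f b) <= C * nA (a - b)) ->
  tends u l -> tends (f \o u) (f l).
Proof.
move=> C0 fC ul e e0; have [|N Nu] := ul (e / (C + 1)).
  by rewrite divr_gt0// ltr_wpDl.
exists N => n /Nu un; rewrite /= (le_trans (fC _ _))//.
have C1 : 0 < C + 1 by rewrite ltr_wpDl.
rewrite (@le_trans _ _ ((C + 1) * (e / (C + 1))))//.
  by rewrite ler_pM// ?nA_ge0// lerDl.
by rewrite mulrC divfK// gt_eqF.
Qed.

Lemma tends_star u l : tends u l -> tends (star \o u) (star l).
Proof.
by apply: (@tends_lip _ _ _ 1) => // a b; rewrite -starB nA_star mul1r.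
Qed.

Lemma tendsMl u l a : tends u l -> tends (fun n => a * u n) (a * l).
Proof.
by apply: (@tends_lip _ _ _ (nA a)) => [|b c]; rewrite ?nA_ge0// -mulrBr nAM.
Qed.

Lemma tendsMr u l a : tends u l -> tends (fun n => u n * a) (l * a).
Proof.
apply: (@tends_lip _ _ (fun b => b * a) (nA a)) => [|b c]; rewrite ?nA_ge0//.
by rewrite -mulrBl mulrC nAM.
Qed.

End CRing.
(** * Square roots *)

Lemma geometric_small (R : realType) (C q e : R) :
  0 <= q -> q < 1 -> 0 < e -> exists k, C * q ^+ k <= e.
Proof.
move=> q0 q1 e0.
have : (geometric C q) @ \oo --> 0.
  by apply: cvg_geometric; rewrite ger0_norm.
move/cvgrPdist_le => /(_ _ e0)[k _ /(_ k (leqnn k))] /=.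
by rewrite sub0r normrN => /ler_normlW ?; exists k.
Qed.

Lemma geometric_dist (R : realType) (d : nat -> nat -> R) C q :
  0 <= C -> 0 <= q -> q < 1 -> (forall k, d k k <= 0) ->
  (forall k j, d k j.+1 <= d k j + d j j.+1) ->
  (forall j, d j j.+1 <= C * q ^+ j) ->
  forall k j, (k <= j)%N -> d k j <= C / (1 - q) * q ^+ k.
Proof.
move=> C0 q0 q1 d0 dD dC k j; have q1' : 0 < 1 - q by rewrite subr_gt0.
suff dj i : d k (k + i)%N + C / (1 - q) * q ^+ (k + i) <= C / (1 - q) * q ^+ k.
  move=> kj; have := dj (j - k)%N; rewrite subnKC//; apply: le_trans.
  by rewrite lerDl mulr_ge0 ?exprn_ge0// divr_ge0// ltW.
elim: i => [|i IH]; first by rewrite addn0 gerDr.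
rewrite addnS; apply: le_trans IH; have := dD k (k + i)%N.
have := dC (k + i)%N; rewrite exprS.
suff : C * q ^+ (k + i) = C / (1 - q) * q ^+ (k + i) * (1 - q) by nra.
by rewrite mulrAC divfK// gt_eqF.
Qed.

Section SquareRoot.
Context {R : realType} {A : cstarAlgType R}.
Implicit Types a b p q r x y z : cring A.

(** The root is [1 - y], where [y] is the fixed point of [y = (x + y * y) / 2].  This map
    is a contraction of the ball whose radius [rho] satisfies the same equation with
    [nA x] in place of [x].  As a limit of polynomials in [x], the root commutes with
    whatever commutes with [x]. *)
Lemma sqrt_one_sub x : star x = x -> nA x < 1 ->
  exists s, [/\ star s = s, s * s = 1 - x
    & forall z, x * z = z * x -> s * z = z * s].
Proof.
move=> sx x1.
pose rho := 1 - Num.sqrt (1 - nA x).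
have x1' : 0 <= 1 - nA x by lra.
have s1 : 0 < Num.sqrt (1 - nA x) by rewrite sqrtr_gt0; lra.
have s2 := sqr_sqrtr x1'.
have nx0 := nA_ge0 x.
have rho0 : 0 <= rho by rewrite /rho; nra.
have rho1 : rho < 1 by rewrite /rho; lra.
(* [rho] is the smaller root of [t = (nA x + t ^ 2) / 2]. *)
have rhoE : nA x + rho * rho = 2 * rho by rewrite /rho; nra.
pose f y := (2^-1 : R) *: (x + y * y).
pose u n := iter n f 0.
have urho n : nA (u n) <= rho.
  elim: n => [|n IH]; first by rewrite nA0.
  rewrite /u iterS -/(u n) nAZ ger0_norm ?invr_ge0//.
  have h : nA (x + u n * u n) <= nA x + rho * rho.
    rewrite (le_trans (nAD _ _))// lerD2l (le_trans (nAM _ _))//.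
    by rewrite ler_pM ?nA_ge0.
  rewrite rhoE in h; lra.
have fL y z : nA y <= rho -> nA z <= rho -> nA (f y - f z) <= rho * nA (y - z).
  move=> yr zr; rewrite /f -scalerBr nAZ ger0_norm ?invr_ge0//.
  have -> : x + y * y - (x + z * z) = y * (y - z) + (y - z) * z.
    by rewrite mulrBr mulrBl addrA subrK opprD addrACA subrr add0r.
  have := nAD (y * (y - z)) ((y - z) * z); have := nAM y (y - z).
  have := nAM (y - z) z; have := nA_ge0 (y - z); nra.
have uS n : nA (u n.+1 - u n) <= nA (u 1%N) * rho ^+ n.
  elim: n => [|n IH]; first by rewrite subr0 mulr1.
  rewrite exprS mulrCA; apply: le_trans (fL _ _ (urho n.+1) (urho n)) _.
  by rewrite ler_wpM2l.
have [||y uy _] := @cring_complete _ _ u (fun k => nA (u 1%N) / (1 - rho) * rho ^+ k).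
- move=> k j; apply: (@geometric_dist _ (fun k j => nA (u j - u k))); rewrite ?nA_ge0 //.
  + by move=> ?; rewrite subrr nA0.
  + move=> {}k {}j; rewrite (le_trans _ (nAD _ _))//.
    by rewrite [X in _ <= nA X]addrC addrA subrK.
- by move=> e e0; apply: geometric_small.
have yrho : nA y <= rho.
  by rewrite -[y]subr0; apply: (tends_nA_le uy); exists 0%N => n _; rewrite subr0.
have yf : y = f y.
  apply/eqP; rewrite -subr_eq0; apply/eqP/nA_le0; apply: le_of_forall_eps => e e0.
  have [|N Nu] := uy (e / 2); first by rewrite divr_gt0.
  have h1 := Nu _ (leqnSn N); have h2 := Nu _ (leqnn N).
  have h3 := fL _ _ (urho N) yrho.
  have -> : y - f y = (y - u N.+1) + (u N.+1 - f y) by rewrite addrA subrK.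
  have := nAD (y - u N.+1) (u N.+1 - f y).
  rewrite nAC in h2; have := nA_ge0 (u N - y).
  rewrite -/(u N.+1) in h3; nra.
have uz z : x * z = z * x -> y * z = z * y.
  move=> xz; apply: (tends_unique (tendsMr z uy)).
  have -> : (fun n => u n * z) = (fun n => z * u n).
    apply/funext => n; elim: n => [|n IH]; first by rewrite mul0r mulr0.
    rewrite /u iterS -/(u n) /f rscaleAl rscaleAr mulrDl mulrDr xz; congr (_ *: (_ + _)).
    by rewrite -mulrA IH mulrA IH mulrA.
  exact: tendsMl.
have sy : star y = y.
  apply: (tends_unique (tends_star uy)).
  rewrite (_ : star \o u = u)//.
  apply/funext => n /=; elim: n => [|n IH]; first exact: star0.
  by rewrite /u iterS -/(u n) /f starZ starD starM IH sx.
exists (1 - y); split.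
- by rewrite starB star1 sy.
- rewrite mulrBl mul1r mulrBr mulr1.
  have y2 : y + y = x + y * y.
    by rewrite {1 2}yf -scalerDl -[RHS]scale1r; congr (_ *: _); lra.
  have -> : x = y + y - y * y by rewrite y2 addrK.
  by rewrite -(addrA y y) [in RHS]opprD addrA.
- by move=> z /uz zy; rewrite mulrBl mulrBr mul1r mulr1 zy.
Qed.

End SquareRoot.
(** * Positive elements *)

Section Positive.
Context {R : realType} {A : cstarAlgType R}.
Implicit Types a b p q r s x y z : cring A.
Local Notation I1 := (1 : cring A).

(** Positivity without spectra: for a self-adjoint [p], the ball condition says that
    the spectrum of [p] lies in the interval from [0] to [2 * t].  It makes closure
    under sums immediate. *)
Definition pos p : Prop :=
  star p = p /\ exists2 t : R, 0 <= t & nA (t *: I1 - p) <= t.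

Lemma rscale_halve a : a = (2^-1 : R) *: (a + a).
Proof. by rewrite -[in RHS](scale1r a) -scalerDl scalerA mulVf ?scale1r. Qed.

Lemma nA_scal1 (c : R) : 0 <= c -> nA (c *: I1) <= c.
Proof. by move=> c0; rewrite nAZ ger0_norm// ler_piMr// nA1_le1. Qed.

Lemma star_scal1 (c : R) : star (c *: I1) = c *: I1.
Proof. by rewrite starZ star1. Qed.

(** The element [w = s + i r] has [star w * w = s * s + r * r], and [r] is its imaginary
    part. *)
Lemma commuting_norm_le r s : star r = r -> star s = s -> r * s = s * r ->
  nA r ^+ 2 <= nA (s * s + r * r).
Proof.
move=> sr ss rs; pose w := s + imul r.
have sw : star w = s - imul r by rewrite starD star_imul ss sr.
have ww : star w * w = s * s + r * r.
  rewrite sw mulrBl !mulrDr !imulAl !imulAr imul2 rs opprD opprK.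
  by rewrite addrA addrK.
have : nA (imul r) <= nA w.
  rewrite (rscale_halve (imul r)) (_ : _ + _ = w - star w); last first.
    by rewrite sw opprB [RHS]addrC addrA subrK.
  rewrite nAZ ger0_norm ?invr_ge0//; have := nAB w (star w).
  by rewrite nA_star; lra.
rewrite nA_imul -ww nA_cstar => h; rewrite lerXn2r// nnegrE; exact: nA_ge0.
Qed.

(** If [s] is a square root of [1 - r * r], then [r + i s] is unitary, so its imaginary
    part [s] has norm at most one. *)
Lemma nA_one_sub_sqr r : star r = r -> nA r < 1 -> nA (1 - r * r) <= 1.
Proof.
move=> sr r1; have r0 := nA_ge0 r.
have rr1 : nA (r * r) < 1 by rewrite (le_lt_trans (nAM _ _))//; nra.
have [|s [ss s2 sc]] := @sqrt_one_sub _ _ (r * r) _ rr1; first by rewrite starM sr.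
have rs : s * r = r * s by apply: sc; rewrite mulrA.
have := commuting_norm_le ss sr rs.
by rewrite s2 [r * r + _]addrC subrK -nA_sa_sqr// expr2 s2 => /le_trans; apply; exact: nA1_le1.
Qed.

Lemma posD p q : pos p -> pos q -> pos (p + q).
Proof.
move=> [sp [t t0 tp]] [sq [u u0 uq]]; split; first by rewrite starD sp sq.
exists (t + u); first exact: addr_ge0.
by rewrite scalerDl opprD addrACA (le_trans (nAD _ _))// lerD.
Qed.

Lemma posZ (c : R) p : 0 <= c -> pos p -> pos (c *: p).
Proof.
move=> c0 [sp [t t0 tp]]; split; first by rewrite starZ sp.
exists (c * t); first exact: mulr_ge0.
by rewrite -scalerA -scalerBr nAZ ger0_norm// ler_wpM2l.
Qed.

Lemma pos_upper p (c : R) : star p = p -> nA p <= c -> pos (c *: I1 - p).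
Proof.
move=> sp pc; split; first by rewrite starB star_scal1 sp.
exists c; first exact: le_trans (nA_ge0 p) pc.
by rewrite opprB addrC subrK.
Qed.

Lemma pos_sqr r : star r = r -> pos (r * r).
Proof.
move=> sr; split; first by rewrite starM sr.
have r0 := nA_ge0 r; have r1 : 0 < nA r + 1 by rewrite ltr_wpDl.
exists ((nA r + 1) ^+ 2); first exact: sqr_ge0.
pose s := (nA r + 1)^-1 *: r.
have -> : r * r = (nA r + 1) ^+ 2 *: (s * s).
  by rewrite rscaleAl rscaleAr !scalerA expr2 mulrACA divff ?gt_eqF// mulr1 scale1r.
rewrite -scalerBr nAZ ger0_norm ?sqr_ge0// ler_piMr ?sqr_ge0//.
apply: nA_one_sub_sqr; first by rewrite starZ sr.
rewrite nAZ ger0_norm ?invr_ge0 ?ltW// mulrC ltr_pdivrMr//; lra.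
Qed.

Lemma pos_sqrt p (e : R) : pos p -> 0 < e -> exists r,
  [/\ star r = r, r * r = p + e *: I1 & forall z, p * z = z * p -> r * z = z * r].
Proof.
move=> [sp [t t0 tp]] e0; have te : 0 < t + e by rewrite ltr_wpDl.
pose x := (t + e)^-1 *: (t *: I1 - p).
have sx : star x = x by rewrite starZ starB star_scal1 sp.
have [|s [ss s2 sc]] := sqrt_one_sub sx.
  by rewrite nAZ ger0_norm ?invr_ge0 ?ltW// mulrC ltr_pdivrMr//; lra.
exists (Num.sqrt (t + e) *: s); split.
- by rewrite starZ ss.
- rewrite rscaleAl rscaleAr scalerA -expr2 sqr_sqrtr ?ltW// s2 scalerBr.
  rewrite scalerA mulfV ?gt_eqF// scale1r scalerDl opprB.
  by rewrite [LHS]addrC addrA subrK.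
- move=> z pz; rewrite rscaleAl rscaleAr sc// rscaleAl rscaleAr; congr (_ *: _).
  by rewrite mulrBl mulrBr rscaleAl rscaleAr mul1r mulr1 pz.
Qed.

(** Roots [r] of [p + e] and [s] of [c - p + e] commute, and [s + i r] has squared modulus
    [c + 2 e]; hence [nA p] exceeds [c] by at most a multiple of [e]. *)
Lemma pos_le p (c : R) : 0 <= c -> pos p -> pos (c *: I1 - p) -> nA p <= c.
Proof.
move=> c0 pp pcp; apply: le_of_forall_eps => e e0.
have e3 : 0 < e / 3 by rewrite divr_gt0.
have [r [sr r2 rc]] := pos_sqrt pp e3.
have [s [ss s2 sc]] := pos_sqrt pcp e3.
have rs : r * s = s * r.
  by apply/rc/esym/sc; rewrite mulrBl mulrBr rscaleAl rscaleAr mul1r mulr1.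
have := commuting_norm_le sr ss rs.
rewrite -nA_sa_sqr// expr2 s2 r2 addrACA subrK -!(scalerDl I1) => h.
have {}h := le_trans h (nA_scal1 _).
have : nA (p + (e / 3) *: I1) <= c + (e / 3 + e / 3) by apply: h; lra.
have := nAB (p + (e / 3) *: I1) ((e / 3) *: I1); rewrite addrK.
have := nA_scal1 (ltW e3); lra.
Qed.

Lemma pos_dist p (t : R) : pos p -> nA p <= t -> nA (t *: I1 - p) <= t.
Proof.
move=> pp pt; apply: pos_le; first exact: le_trans (nA_ge0 _) pt.
  by apply: pos_upper => //; case: pp.
by rewrite opprB addrC subrK.
Qed.

Lemma nA_mono p q : pos p -> pos q -> nA p <= nA (p + q).
Proof.
move=> pp pq; apply: pos_le => //; first exact: nA_ge0.
have spq : star (p + q) = p + q by case: (posD pp pq).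
have := posD (pos_upper spq (lexx _)) pq.
by rewrite opprD addrA subrK.
Qed.

(** By [pos_dist] the radius witnessing positivity can be chosen independently of [e]. *)
Lemma pos_closed p q : star p = p ->
  (forall e : R, 0 < e -> pos (p + e *: q)) -> pos p.
Proof.
move=> sp pq; split => //; exists (nA p + nA q); first by rewrite addr_ge0 ?nA_ge0.
apply: le_of_forall_eps => e e0; have q0 := nA_ge0 q.
have q1 : 0 < nA q + 1 by rewrite ltr_wpDl.
pose d := Num.min 1 (e / (nA q + 1)).
have d0 : 0 < d by rewrite lt_min ltr01 divr_gt0.
have d1 : d <= 1 by rewrite ge_min lexx.
have dq : d * nA q <= e.
  have : d <= e / (nA q + 1) by rewrite ge_min lexx orbT.
  by rewrite ler_pdivlMr//; nra.
have ndq : nA (d *: q) = d * nA q by rewrite nAZ ger0_norm// ltW.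
have h : nA (p + d *: q) <= nA p + nA q.
  by rewrite (le_trans (nAD _ _))// lerD2l ndq ler_piMl.
have := pos_dist (pq _ d0) h.
set t := _ *: I1 => h2; have := nAD (t - (p + d *: q)) (d *: q).
have -> : t - (p + d *: q) + d *: q = t - p by rewrite opprD addrA subrK.
by rewrite ndq; lra.
Qed.

Lemma pos_scal1 (c : R) : 0 <= c -> pos (c *: I1).
Proof.
by move=> c0; apply: posZ => //; have := pos_sqr star1; rewrite mulr1.
Qed.

(** If [r] is a root of [a + e], then [y * a * y] differs from the square of the
    self-adjoint element [r * y] only by [e *: (y * y)]. *)
Lemma pos_conj_commuting a y : pos a -> star y = y -> a * y = y * a ->
  pos (y * a * y).
Proof.
move=> pa sy ay; have sa : star a = a by case: pa.
apply: (@pos_closed _ (y * y)); first by rewrite !starM sa sy mulrA.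
move=> e e0; have [r [sr r2 rc]] := pos_sqrt pa e0.
have -> : y * a * y + e *: (y * y) = (r * y) * (r * y).
  rewrite {1}(rc _ ay) -(mulrA y r) (mulrA r r) r2 mulrDl mulrDr rscaleAl mul1r.
  by rewrite rscaleAr mulrA.
by apply: pos_sqr; rewrite starM sr sy rc.
Qed.

(** Exchanging [b] and [star b] in a power costs only a sum whose number of terms grows
    linearly with the exponent. *)
Lemma one_sub_swap_expr b (t : R) n :
  (1 - t *: (star b * b)) ^+ n =
  1 - t *: (\sum_(j < n) star b * (1 - t *: (b * star b)) ^+ j * b).
Proof.
elim: n => [|n IH]; first by rewrite big_ord0 scaler0 subr0.
rewrite exprSr big_ord_recr/= scalerDr opprD addrA -IH mulrBr mulr1; congr (_ - _).
rewrite rscaleAr mulrA.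
suff -> : (1 - t *: (star b * b)) ^+ n * star b =
  star b * (1 - t *: (b * star b)) ^+ n by [].
elim: n {IH} => [|n IH]; first by rewrite mul1r mulr1.
rewrite exprS -mulrA IH exprS mulrA mulrA mulrBl mulrBr mul1r mulr1; congr ((_ - _) * _).
by rewrite rscaleAl rscaleAr mulrA.
Qed.

Lemma expr_linear_bound (be C : R) : 0 <= be -> 0 <= C ->
  (forall m, be ^+ (2 ^ m) <= 1 + C * (2 ^ m)%:R) -> be <= 1.
Proof.
move=> be0 C0 beC; rewrite leNgt; apply/negP => be1.
pose g := be - 1; have g0 : 0 < g by rewrite subr_gt0.
have bernoulli n : n%:R * g <= be ^+ n.
  suff : 1 + n%:R * g <= be ^+ n by lra.
  elim: n => [|n IH]; first by rewrite mul0r addr0.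
  rewrite exprS -natr1; have : 0 <= n%:R * g * g by rewrite !mulr_ge0// ltW.
  have beE : be = 1 + g by rewrite addrC subrK.
  have := ler_wpM2l be0 IH; nra.
have gg0 : 0 < g ^+ 2 by rewrite exprn_gt0.
have bound m : (2 ^ m)%:R <= (1 + 2 * C) / g ^+ 2 :> R.
  rewrite ler_pdivlMr//; have := beC m.+1; rewrite expnSr exprM natrM.
  have := bernoulli (2 ^ m)%N; set N : R := (2 ^ m)%:R => h1 h2.
  have N1 : 1 <= N by rewrite ler1n expn_gt0.
  have : (N * g) ^+ 2 <= (be ^+ (2 ^ m)) ^+ 2.
    by rewrite lerXn2r// nnegrE ?exprn_ge0// mulr_ge0// ltW.
  move/le_trans => /(_ _ h2) h3.
  have {}h3 : N * (N * g ^+ 2) <= N * (1 + 2 * C).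
    apply: le_trans (_ : 1 + C * (N * 2) <= _); last by nra.
    by apply: le_trans h3; rewrite le_eqVlt; apply/orP; left; apply/eqP; ring.
  by rewrite ler_pM2l// in h3; lra.
have := bound (Num.bound ((1 + 2 * C) / g ^+ 2)).
apply/negP; rewrite -ltNge.
apply: lt_trans (archi_boundP _) _; first by rewrite divr_ge0 ?ltW//; lra.
by rewrite ltr_nat ltn_expl.
Qed.

(** The norm of the [2 ^ m]-th power of a self-adjoint element is exactly the power of
    its norm, so the linear factor of [one_sub_swap_expr] disappears in the limit.  This
    replaces the equality of the nonzero spectra of [b * star b] and [star b * b]. *)
Lemma nA_one_sub_swap b (t rho : R) : 0 <= t -> 1 <= rho ->
  nA (1 - t *: (b * star b)) <= rho -> nA (1 - t *: (star b * b)) <= rho.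
Proof.
move=> t0 rho1 brho; set k := 1 - _; have rho0 : 0 < rho by lra.
have sk : star k = k by rewrite starB star1 starZ starM starK.
rewrite -[X in _ <= X]mul1r -ler_pdivrMr//.
apply: (@expr_linear_bound _ (t * nA b ^+ 2)).
- by rewrite divr_ge0 ?nA_ge0// ltW.
- by rewrite mulr_ge0 ?sqr_ge0.
move=> m; rewrite expr_div_n -nA_saX2//; set n := (2 ^ m)%N.
rewrite ler_pdivrMr ?exprn_gt0// one_sub_swap_expr.
apply: le_trans (nAB _ _) _; rewrite mulrDl mul1r lerD//.
  by rewrite (le_trans nA1_le1)// exprn_ege1.
rewrite nAZ ger0_norm// -!mulrA ler_wpM2l//.
apply: le_trans (nA_sum _ _ _) _.
apply: le_trans (_ : \sum_(j < n) nA b ^+ 2 * rho ^+ n <= _); last first.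
  rewrite sumr_const card_ord -mulr_natl mulrCA.
  by rewrite le_eqVlt; apply/orP; left; apply/eqP; ring.
apply: ler_sum => j _; rewrite expr2 mulrAC.
apply: le_trans (nAM _ _) _; rewrite ler_wpM2r ?nA_ge0//.
apply: le_trans (nAM _ _) _; rewrite nA_star ler_wpM2l ?nA_ge0//.
apply: le_trans (nAX _ _) _; apply: le_trans (_ : rho ^+ j <= _).
  by rewrite lerXn2r// ?nnegrE ?nA_ge0// ltW.
by rewrite ler_weXn2l// ltnW.
Qed.

Lemma pos_swap b (d : R) : 0 <= d ->
  pos (b * star b + d *: I1) -> pos (star b * b + d *: I1).
Proof.
move=> d0 [_ [t t0 bt]]; split.
  by rewrite starD starM starK star_scal1.
have u0 : 0 < t + 1 by rewrite ltr_wpDl.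
have bu : nA ((t + 1) *: I1 - (b * star b + d *: I1)) <= t + 1.
  rewrite scalerDl addrAC (le_trans (nAD _ _))// lerD// scale1r; exact: nA1_le1.
exists (t + 1 + d); first by lra.
rewrite scalerDl opprD addrACA subrr addr0.
have scl x : (t + 1) *: I1 - x = (t + 1) *: (1 - (t + 1)^-1 *: x).
  by rewrite scalerBr scalerA divff ?gt_eqF// scale1r.
have rhoE : t + 1 + d = (t + 1) * (1 + (t + 1)^-1 * d).
  by rewrite mulrDr mulr1 mulrA divff ?gt_eqF// mul1r.
rewrite scl nAZ (gtr0_norm u0) rhoE ler_pM2l//.
apply: nA_one_sub_swap; first by rewrite invr_ge0 ltW.
  by rewrite lerDl mulr_ge0// invr_ge0 ltW.
rewrite -(ler_pM2l u0) -rhoE -[X in X * _](gtr0_norm u0) -nAZ -scl.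
have -> : (t + 1) *: I1 - b * star b =
    (t + 1) *: I1 - (b * star b + d *: I1) + d *: I1 by rewrite opprD addrA subrK.
by rewrite (le_trans (nAD _ _))// lerD// nA_scal1.
Qed.

End Positive.
(** * Positivity of star x * x *)

Section Kaplansky.
Context {R : realType} {A : cstarAlgType R}.
Implicit Types a b p q r s x y z : cring A.
Local Notation I1 := (1 : cring A).

Lemma pos1 : pos I1. Proof. by have := pos_sqr (@star1 R A); rewrite mulr1. Qed.

Lemma pos0 : pos (0 : cring A).
Proof. by rewrite -(scale0r I1); exact: pos_scal1. Qed.

Lemma posX a m : pos a -> pos (a ^+ m).
Proof.
move=> pa; have sa : star a = a by case: pa.
suff : pos (a ^+ m) /\ pos (a ^+ m.+1) by case.
elim: m => [|m [IH1 IH2]]; first by rewrite expr1; split => //; exact: pos1.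
split=> //; rewrite exprSr exprS; apply: pos_conj_commuting => //.
by rewrite -exprS -exprSr.
Qed.

(** This is the scalar inequality [(1 - a) a^m <= 1/m].  The defect
    [1 - a^m - m (1 - a) a^m] grows by [(m + 1) (1 - a) a^m (1 - a)] when [m] grows by one. *)
Lemma pos_one_sub_expr a m : pos a ->
  pos (I1 - m%:R *: ((1 - a) * a ^+ m)).
Proof.
move=> pa; have sa : star a = a by case: pa.
suff : pos (I1 - a ^+ m - m%:R *: ((1 - a) * a ^+ m)).
  by move=> /posD - /(_ _ (posX m pa)); rewrite addrAC subrK.
elim: m => [|m IH]; first by rewrite subrr scale0r subr0; exact: pos0.
have := pos_conj_commuting (posX m pa) (_ : star (1 - a) = 1 - a) _.
rewrite starB star1 sa => /(_ erefl).
have -> : a ^+ m * (1 - a) = (1 - a) * a ^+ m.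
  by rewrite mulrBl mulrBr mulr1 mul1r -exprS -exprSr.
move=> /(_ erefl) /(posZ (ler0n R m.+1)) /(posD IH).
rewrite -natr1; set c := (1 - a) * a ^+ m.
have -> : (1 - a) * a ^+ m.+1 = c * a by rewrite exprSr mulrA.
have -> : a ^+ m.+1 = a ^+ m - c by rewrite /c mulrBl mul1r -exprS opprB addrC subrK.
rewrite mulrBr mulr1 scalerBr !scalerDl !scale1r.
suff -> : I1 - a ^+ m - m%:R *: c + (m%:R *: c + c - (m%:R *: (c * a) + c * a)) =
   1 - (a ^+ m - c) - (m%:R *: (c * a) + c * a) by [].
by rewrite opprB !addrA subrK (addrAC 1 c).
Qed.

(** The sum [star b * b + b * star b] is half the sum of the squares of [b + star b] and of
    [i (b - star b)]. *)
Lemma cartesian_sum b : exists p, pos p /\ star b * b = p - b * star b.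
Proof.
pose c := b + star b; pose d := imul (b - star b).
have sc : star c = c by rewrite starD starK addrC.
have sd : star d = d by rewrite star_imul starB starK -imulN opprB.
exists (2^-1 *: (c * c + d * d)); split.
  by apply: posZ; [rewrite invr_ge0|apply: posD; exact: pos_sqr].
suff -> : c * c + d * d = (b * star b + star b * b) + (b * star b + star b * b).
  by rewrite -rscale_halve addrC addKr.
rewrite /c /d imulAl imulAr imul2 !mulrDl !mulrDr !mulNr !mulrN !opprK.
set bb := b * b; set ss := star b * star b; set sb := star b * b.
set bs := b * star b.
rewrite [X in _ + - X](_ : _ = (bb - bs) - (sb - ss)); last by rewrite opprB [- sb + _]addrC.
rewrite !opprB [_ - _ + (bs - bb)]addrC addrACA [bb + bs]addrC.
by rewrite (addrACA bs) (addrACA sb) !subrr !addr0 addrACA.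
Qed.

(** Kaplansky's theorem.  Let [h = star x * x] have norm at most one, put [a = 1 - h] and
    [b = x a^n], so that [star b * b = (1 - a) a^(2n)], which is at most [1/2n].  By
    [cartesian_sum], [b * star b] is at least [-1/2n], and by [pos_swap] so is [star b * b].
    Thus [(1 - a) a^m] has norm at most [3/m] for all powers of two [m > 1], which is
    impossible if [nA a > 1]; and [nA a <= 1] is the positivity of [h]. *)
Lemma pos_star_mul x : pos (star x * x).
Proof.
wlog x1 : x / nA (star x * x) <= 1.
  move=> wl; have n1 : 0 < nA x + 1 by rewrite ltr_wpDl ?nA_ge0.
  pose y := (nA x + 1)^-1 *: x.
  have -> : star x * x = (nA x + 1) ^+ 2 *: (star y * y).
    rewrite starZ rscaleAl rscaleAr !scalerA expr2 mulrA mulfK ?gt_eqF//.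
    by rewrite divff ?gt_eqF// scale1r.
  apply: posZ; first exact: sqr_ge0.
  apply: wl; rewrite nA_cstar expr_le1 ?nA_ge0// nAZ gtr0_norm ?invr_gt0//.
  by rewrite ler_pdivrMl// mulr1 lerDl.
set h := star x * x in x1 *; have sh : star h = h by rewrite starM starK.
pose a : cring A := 1 - h.
have pa : pos a by have := pos_upper sh x1; rewrite scale1r.
have sa : star a = a by case: pa.
split=> //; exists 1 => //; rewrite scale1r -/a.
have kE j : let m := (2 ^ j.+1)%N in nA ((1 - a) * a ^+ m) <= 3 / m%:R.
  move=> m; have m0 : 0 < m%:R :> R by rewrite ltr0n expn_gt0.
  have im0 : 0 < m%:R^-1 :> R by rewrite invr_gt0.
  (* The exponent makes [star b * b] equal to [(1 - a) a^m], with [m] a power of two. *)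
  pose b := x * a ^+ (2 ^ j).
  have bbE : star b * b = (1 - a) * a ^+ m.
    rewrite starM starX sa mulrA -[_ * star x * x]mulrA -/h opprB addrC subrK.
    have : h * a = a * h by rewrite mulrBl mulrBr mul1r mulr1.
    move/commrX => /(_ (2 ^ j)%N) <-.
    by rewrite -mulrA -exprD addnn -mul2n -expnS.
  have kle : pos (m%:R^-1 *: I1 - star b * b).
    have := posZ (ltW im0) (pos_one_sub_expr m pa).
    by rewrite bbE scalerBr scalerA mulVf ?gt_eqF// scale1r.
  have lge : pos (b * star b + m%:R^-1 *: I1).
    have [p [pp bp]] := cartesian_sum b.
    have := posD pp kle; rewrite bp opprB.
    suff -> : p + (m%:R^-1 *: I1 + (b * star b - p)) = b * star b + m%:R^-1 *: I1 by [].
    by rewrite addrCA [p + _]addrC subrK addrC.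
  have kge := pos_swap (ltW im0) lge.
  have : nA (star b * b + m%:R^-1 *: I1) <= 2 * m%:R^-1.
    apply: (pos_le _ kge); first by rewrite mulr_ge0// invr_ge0.
    rewrite mulr_natl mulr2n scalerDl opprD addrCA !addrA.
    by rewrite addrK addrC.
  have := nAB (star b * b + m%:R^-1 *: I1) (m%:R^-1 *: I1).
  by rewrite addrK bbE; have := @nA_scal1 _ A _ (ltW im0); lra.
rewrite leNgt; apply/negP => a1; set al := nA a in a1.
have kge j : let m := (2 ^ j.+1)%N in al - 1 <= nA ((1 - a) * a ^+ m).
  move=> m; have al0 : 0 < al by lra.
  have m0 : (0 < m)%N by rewrite expn_gt0.
  have alm : 1 <= al ^+ m by rewrite exprn_ege1// ltW.
  (* Norms of powers are exact only at exponents [2 ^ i]: factor [a ^ (2 m)]. *)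
  have h1 : al ^+ m.+1 <= nA (a ^+ m.+1).
    rewrite -(ler_pM2r (exprn_gt0 m.-1 al0)) -exprD addSnnS prednK// addnn -mul2n.
    rewrite -expnS -nA_saX2// expnS mul2n -addnn -[X in (X + _)%N]prednK// addSnnS.
    rewrite addnC exprD; apply: le_trans (nAM _ _) _.
    by rewrite ler_wpM2l ?nA_ge0// nAX.
  have := nAB (a ^+ m) ((1 - a) * a ^+ m).
  rewrite mulrBl mul1r -exprS opprB [X in nA X <= _]addrC subrK nA_saX2// -/al.
  have : 0 <= (al - 1) * (al ^+ m - 1) by rewrite mulr_ge0//; lra.
  by rewrite exprS in h1 *; lra.
have := archi_boundP (_ : 0 <= 3 / (al - 1)).
set B := Num.bound _ => /(_ _); rewrite divr_ge0//; last by lra.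
move=> /(_ isT); apply/negP; rewrite -leNgt.
apply: le_trans (_ : (2 ^ B.+1)%:R <= _).
  by rewrite ler_nat (leq_trans (leqnSn _))// ltnW// ltn_expl.
have := le_trans (kge B) (kE B); rewrite ler_pdivlMr ?ltr0n ?expn_gt0//.
by rewrite ler_pdivlMr 1?mulrC// subr_gt0.
Qed.

End Kaplansky.
(** * The Cauchy-Schwarz inequality for finite sums *)

Section FiniteSums.
Context {R : realType} {A : cstarAlgType R}.
Implicit Types (x y z : nat -> A) (r : seq nat).
Local Notation I1 := (1 : cring A).

Lemma pos_conj (p a : cring A) : pos p -> pos (star a * p * a).
Proof.
move=> pp; have sp : star p = p by case: pp.
apply: (@pos_closed _ _ _ (star a * a)); first by rewrite !starM starK sp mulrA.
move=> e e0; have [r [sr r2 _]] := pos_sqrt pp e0.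
have := pos_star_mul (r * a); rewrite starM sr -mulrA (mulrA r) r2.
by rewrite mulrDl rscaleAl mul1r mulrDr rscaleAr mulrA.
Qed.

Definition fip r x y : cring A := \sum_(i <- r) star (x i) * y i.

Lemma pos_fip r x : pos (fip r x x).
Proof.
apply: (big_ind (@pos _ A)) => [|a b|i _]; [exact: pos0|exact: posD|].
exact: pos_star_mul.
Qed.

Lemma fipD r x y z : fip r x (y + z) = fip r x y + fip r x z.
Proof. by rewrite /fip -big_split; apply: eq_bigr => i _; exact: mulrDr. Qed.

Lemma fip_rscale r x y a : fip r x (rscale y a) = fip r x y * a.
Proof. by rewrite /fip big_distrl; apply: eq_bigr => i _; exact: mulrA. Qed.

Lemma fip_star r x y : star (fip r x y) = fip r y x.
Proof. by rewrite star_sum; apply: eq_bigr => i _; rewrite starM starK. Qed.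

Lemma fipDl r x y z : fip r (y + z) x = fip r y x + fip r z x.
Proof. by rewrite -fip_star fipD starD !fip_star. Qed.

Lemma fip_rscalel r x y a : fip r (rscale y a) x = star a * fip r y x.
Proof. by rewrite -fip_star fip_rscale starM !fip_star. Qed.

(** For [a] the inner product of [x] and [y] and a scalar [c] above the norm of that of [x]
    with itself, expand the positive inner product of [c y - x a] with itself. *)
Lemma fip_cauchy_schwarz r x y :
  nA (fip r x y) ^+ 2 <= nA (fip r x x) * nA (fip r y y).
Proof.
set a := fip r x y; set p := fip r x x; set q := fip r y y.
suff h (c : R) : 0 < c -> nA p <= c -> nA a ^+ 2 <= c * nA q.
  apply: le_of_forall_eps => e e0; have q0 := nA_ge0 q.
  have q1 : 0 < nA q + 1 by lra.
  have d0 : 0 < e / (nA q + 1) by rewrite divr_gt0.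
  apply: le_trans (h (nA p + e / (nA q + 1)) _ _) _.
  - by have := nA_ge0 p; lra.
  - by rewrite lerDl ltW.
  - rewrite mulrDl lerD2l -[X in _ <= X](@divfK _ (nA q + 1)) ?gt_eqF//.
    by rewrite ler_pM2l// lerDl.
move=> c0 pc; have sp : star p = p by case: (pos_fip r x).
pose w := rscale y (c *: I1) + rscale x (- a).
have wE : fip r w w = c *: (c *: q - star a * a) - star a * (c *: I1 - p) * a.
  rewrite /w fipD !fipDl !fip_rscale !fip_rscalel star_scal1 starN.
  rewrite -/q -/a -/p -[fip r y x]fip_star -/a.
  rewrite !(rscaleAl, rscaleAr, mulr1, mul1r, mulNr, mulrN, opprK).
  rewrite mulrBr mulrBl !(rscaleAl, rscaleAr, mulr1, mul1r) scalerBr opprB.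
  by rewrite scalerN [- _ + _]addrC.
have pcp := pos_upper sp pc.
have := posD (pos_fip r w) (pos_conj a pcp); rewrite wE subrK.
have ic0 : 0 <= c^-1 by rewrite invr_ge0 ltW.
move/(posZ ic0); rewrite scalerA mulVf ?gt_eqF// scale1r => pq.
have := nA_mono (pos_star_mul a) pq.
by rewrite addrCA subrr addr0 nA_cstar nAZ gtr0_norm.
Qed.

Definition fnorm r x : R := Num.sqrt (nA (fip r x x)).

Lemma fnorm_ge0 r x : 0 <= fnorm r x. Proof. exact: sqrtr_ge0. Qed.

Lemma fnorm2 r x : fnorm r x ^+ 2 = nA (fip r x x).
Proof. by rewrite sqr_sqrtr// nA_ge0. Qed.

Lemma fip_le r x y : nA (fip r x y) <= fnorm r x * fnorm r y.
Proof.
rewrite -(@ler_pXn2r _ 2)// ?nnegrE ?nA_ge0 ?mulr_ge0 ?fnorm_ge0//.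
by rewrite exprMn !fnorm2 fip_cauchy_schwarz.
Qed.

Lemma fnormD r x y : fnorm r (x + y) <= fnorm r x + fnorm r y.
Proof.
rewrite -(@ler_pXn2r _ 2)// ?nnegrE ?addr_ge0 ?fnorm_ge0//.
rewrite fnorm2 fipD !fipDl sqrrD !fnorm2.
have := nAD (fip r x x + fip r y x) (fip r x y + fip r y y).
have := nAD (fip r x x) (fip r y x); have := nAD (fip r x y) (fip r y y).
have := fip_le r x y; have := fip_le r y x; lra.
Qed.

Lemma fnorm_rscale r x a : fnorm r (rscale x a) <= fnorm r x * nA a.
Proof.
rewrite -(@ler_pXn2r _ 2)// ?nnegrE ?mulr_ge0 ?nA_ge0 ?fnorm_ge0//.
rewrite exprMn !fnorm2 fip_rscale fip_rscalel.
apply: le_trans (nAM _ _) _; rewrite expr2 mulrA ler_wpM2r ?nA_ge0//.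
by apply: le_trans (nAM _ _) _; rewrite nA_star mulrC.
Qed.

Lemma fip_range_mono m n k x : (m <= n)%N -> (n <= k)%N ->
  nA (fip (index_iota m n) x x) <= nA (fip (index_iota 0 k) x x).
Proof.
move=> mn nk.
rewrite {2}/fip (big_cat_nat (leq0n m) (leq_trans mn nk))/=.
rewrite [X in _ + X](big_cat_nat mn nk)/=.
rewrite addrCA; apply: nA_mono; first exact: pos_fip.
by apply: posD; exact: pos_fip.
Qed.

End FiniteSums.
(** * The inner product and the norm of the standard module *)

Section StandardModule.
Context {R : realType} {A : cstarAlgType R}.
Implicit Types (x y z : nat -> A) (a b : cring A).
Local Notation I1 := (1 : cring A).
Local Notation iota_ := index_iota.

Definition hin x y : cring A := hinner x y.
Definition nH x : R := Num.sqrt (nA (hin x x)).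

Lemma fip_cat m n x y : (m <= n)%N ->
  fip (iota_ 0 n) x y - fip (iota_ 0 m) x y = fip (iota_ m n) x y.
Proof.
by move=> mn; rewrite /fip (big_cat_nat (leq0n m) mn)/= addrAC subrr add0r.
Qed.

Lemma HA_cvgP x : HA x <-> exists l, tends (fun n => fip (iota_ 0 n) x x) l.
Proof.
split=> [/cvg_ex[/= l xl]|[l xl]]; first by exists l; apply/tendsP.
by apply/cvg_ex; exists l; move/tendsP: xl.
Qed.

(** Membership is a Cauchy criterion on windows of indices, where only the finite
    Cauchy-Schwarz inequality is needed. *)
Lemma HA_cauchyP x : HA x <-> forall e : R, 0 < e -> exists N, forall m n,
  (N <= m)%N -> (m <= n)%N -> fnorm (iota_ m n) x <= e.
Proof.
have fnorm_le (s : seq nat) (e : R) :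
    0 < e -> (fnorm s x <= e) = (nA (fip s x x) <= e ^+ 2).
  by move=> e0; rewrite -fnorm2 ler_pXn2r// nnegrE ?fnorm_ge0 ?ltW.
rewrite HA_cvgP; split=> [[l xl] e e0|xC].
  have [|N Nl] := xl (e ^+ 2 / 2); first by rewrite divr_gt0// exprn_gt0.
  exists N => m n Nm mn; rewrite fnorm_le// -fip_cat//.
  rewrite (_ : _ - _ = (l - fip (iota_ 0 m) x x) - (l - fip (iota_ 0 n) x x)).
    have := Nl _ Nm; have := Nl _ (leq_trans Nm mn).
    by have := nAB (l - fip (iota_ 0 m) x x) (l - fip (iota_ 0 n) x x); lra.
  by rewrite opprB [RHS]addrC addrA subrK.
apply: cauchy_tends => e e0; have s0 : 0 < Num.sqrt e by rewrite sqrtr_gt0.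
have [N Ns] := xC _ s0; exists N => k j Nk kj; rewrite fip_cat//.
by have := Ns _ _ Nk kj; rewrite fnorm_le// sqr_sqrtr// ltW.
Qed.

Lemma tends_hinner x y : HA x -> HA y ->
  tends (fun n => fip (iota_ 0 n) x y) (hin x y).
Proof.
move=> /HA_cauchyP xC /HA_cauchyP yC.
have [e e0|l ul] := @cauchy_tends _ _ (fun n => fip (iota_ 0 n) x y).
  have [N xN] := xC _ ltr01; have [M yM] := yC _ e0.
  exists (maxn N M) => k j; rewrite geq_max => /andP[Nk Mk] kj.
  rewrite fip_cat// (le_trans (fip_le _ _ _))// -[e]mul1r.
  by rewrite ler_pM ?fnorm_ge0 ?xN ?yM.
rewrite (_ : hin x y = l)//; apply: (@norm_cvg_lim _ A); exact/tendsP.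
Qed.

Lemma tends_le (u : nat -> cring A) l (c : R) : tends u l ->
  (forall n, nA (u n) <= c) -> nA l <= c.
Proof.
move=> ul uc; rewrite -[l]subr0; apply: (tends_nA_le ul).
by exists 0%N => n _; rewrite subr0.
Qed.

Lemma nH_ge0 x : 0 <= nH x. Proof. exact: sqrtr_ge0. Qed.

Lemma nH2 x : nH x ^+ 2 = nA (hin x x).
Proof. by rewrite sqr_sqrtr// nA_ge0. Qed.

Lemma hnormE x : hnorm x = (nH x)%:C.
Proof.
rewrite /hnorm nAE -nH2 rmorphXn/= sqrCK// -(rmorph0 (real_complex R)) lecR.
exact: nH_ge0.
Qed.

Lemma nH_leE x (e : R) : 0 <= e -> (nH x <= e) = (nA (hin x x) <= e ^+ 2).
Proof.
by move=> e0; rewrite -nH2 ler_pXn2r// nnegrE ?nH_ge0.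
Qed.

Lemma fnorm_le_nH x m n : HA x -> fnorm (iota_ m n) x <= nH x.
Proof.
move=> hx; rewrite -(@ler_pXn2r _ 2)// ?nnegrE ?nH_ge0 ?fnorm_ge0//.
rewrite nH2 fnorm2; have [mn|nm] := leqP m n; last first.
  by rewrite /fip /iota_ (eqP (ltnW nm)) big_nil nA0 nA_ge0.
apply: le_of_forall_eps => e e0; have [N Nl] := tends_hinner hx hx e0.
have := Nl _ (leq_maxl N n).
have := fip_range_mono x mn (leq_maxr N n).
set f := fip (iota_ 0 _) x x; have := nAD (f - hin x x) (hin x x).
by rewrite subrK nAC; lra.
Qed.

Lemma nH_le_fnorm x (c : R) : HA x -> 0 <= c ->
  (forall n, fnorm (iota_ 0 n) x <= c) -> nH x <= c.
Proof.
move=> hx c0 xc; rewrite nH_leE//; apply: (tends_le (tends_hinner hx hx)) => n.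
by rewrite -fnorm2 ler_pXn2r// ?nnegrE ?fnorm_ge0.
Qed.

Lemma nA_coord_le x i : HA x -> nA (x i) <= nH x.
Proof.
move=> hx; have := fnorm_le_nH i i.+1 hx.
by rewrite /fnorm /fip big_nat1 nA_cstar sqrtr_sqr ger0_norm// nA_ge0.
Qed.

Lemma nA_hin_le x y : HA x -> HA y -> nA (hin x y) <= nH x * nH y.
Proof.
move=> hx hy; apply: (tends_le (tends_hinner hx hy)) => n.
by rewrite (le_trans (fip_le _ _ _))// ler_pM ?fnorm_ge0 ?fnorm_le_nH.
Qed.

Lemma HA0 : HA (0 : nat -> A).
Proof.
apply/HA_cauchyP => e e0; exists 0%N => m n _ _.
by rewrite /fnorm /fip big1 ?nA0 ?sqrtr0 ?ltW// => i _; rewrite mulr0.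
Qed.

Lemma HAD x y : HA x -> HA y -> HA (x + y).
Proof.
move=> /HA_cauchyP xC /HA_cauchyP yC; apply/HA_cauchyP => e e0.
have e2 : 0 < e / 2 by rewrite divr_gt0.
have [N xN] := xC _ e2; have [M yM] := yC _ e2.
exists (maxn N M) => k j; rewrite geq_max => /andP[Nk Mk] kj.
rewrite (le_trans (fnormD _ _ _))//.
by have := xN _ _ Nk kj; have := yM _ _ Mk kj; lra.
Qed.

Lemma HA_rscale x (a : A) : HA x -> HA (rscale x a).
Proof.
move=> /HA_cauchyP xC; apply/HA_cauchyP => e e0.
have a1 : 0 < nA a + 1 by rewrite ltr_wpDl ?nA_ge0.
have [|N xN] := xC (e / (nA a + 1)); first by rewrite divr_gt0.
exists N => m n Nm mn; have := xN _ _ Nm mn; rewrite ler_pdivlMr//.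
apply: le_trans; rewrite (le_trans (fnorm_rscale _ _ _))//.
by rewrite ler_wpM2l ?fnorm_ge0// lerDl.
Qed.

Lemma scale_rscale (c : R[i]) x : c *: x = rscale x (c *: (1 : cring A) : A).
Proof.
apply/funext => i; apply: esym; rewrite /rscale.
by rewrite [LHS](cmulZr c (x i)) cmul1r.
Qed.

Lemma hinDr x y z : HA x -> HA y -> HA z -> hin x (y + z) = hin x y + hin x z.
Proof.
move=> hx hy hz; apply: (tends_unique (tends_hinner hx (HAD hy hz))).
under eq_fun do rewrite fipD.
by apply: tendsD; exact: tends_hinner.
Qed.

Lemma hin_rscale x y (a : A) : HA x -> HA y ->
  hin x (rscale y a) = hin x y * (a : cring A).
Proof.
move=> hx hy; apply: (tends_unique (tends_hinner hx (HA_rscale hy))).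
under eq_fun do rewrite fip_rscale.
by apply: tendsMr; exact: tends_hinner.
Qed.

Lemma hin_star x y : HA x -> HA y -> star (hin x y) = hin y x.
Proof.
move=> hx hy; apply: (tends_unique _ (tends_hinner hy hx)).
under [X in tends X]eq_fun do rewrite -fip_star.
by apply: tends_star; exact: tends_hinner.
Qed.

End StandardModule.
(** * Norm estimates and completeness *)

Section ModuleArith.
Context {R : realType} {A : cstarAlgType R}.
Implicit Types (x y z : nat -> A) (a b : cring A).
Local Notation I1 := (1 : cring A).
Local Notation iota_ := index_iota.

Lemma rscale1 x : rscale x I1 = x.
Proof. by apply/funext => i; exact: cmul1r. Qed.

Lemma rscaleN1 x : rscale x (- I1) = - x.
Proof. by apply/funext => i; rewrite /rscale; exact: (@mulrN1 (cring A)). Qed.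

Lemma rscale0l (a : A) : rscale (0 : nat -> A) a = 0.
Proof. by apply/funext => i; exact: (@mul0r (cring A)). Qed.

Lemma rscaleDl x y (a : A) : rscale (x + y) a = rscale x a + rscale y a.
Proof. by apply/funext => i; exact: (@mulrDl (cring A)). Qed.

Lemma rscale_rscale x a b : rscale (rscale x a) b = rscale x (a * b : cring A).
Proof. by apply/funext => i; apply: esym; exact: (@mulrA (cring A)). Qed.

Lemma rscaleBl x y (a : A) : rscale (x - y) a = rscale x a - rscale y a.
Proof. by apply/funext => i; exact: (@mulrBl (cring A)). Qed.

Lemma HAN x : HA x -> HA (- x).
Proof. by move=> hx; rewrite -rscaleN1; exact: HA_rscale. Qed.

Lemma HAB x y : HA x -> HA y -> HA (x - y).
Proof. by move=> hx hy; apply: HAD => //; exact: HAN. Qed.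

Lemma HAZ (c : R[i]) x : HA x -> HA (c *: x).
Proof. by move=> hx; rewrite scale_rscale; exact: HA_rscale. Qed.

Lemma HA_sum I (r : seq I) (P : pred I) (F : I -> nat -> A) :
  (forall i, P i -> HA (F i)) -> HA (\sum_(i <- r | P i) F i).
Proof. by move=> hF; apply: big_ind => //; [exact: HA0|exact: HAD]. Qed.

Lemma nHD x y : HA x -> HA y -> nH (x + y) <= nH x + nH y.
Proof.
move=> hx hy; apply: nH_le_fnorm; [exact: HAD|by rewrite addr_ge0 ?nH_ge0|].
by move=> n; rewrite (le_trans (fnormD _ _ _))// lerD// fnorm_le_nH.
Qed.

Lemma nH_rscale x a : HA x -> nH (rscale x a) <= nH x * nA a.
Proof.
move=> hx; apply: nH_le_fnorm; [exact: HA_rscale|by rewrite mulr_ge0 ?nH_ge0 ?nA_ge0|].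
by move=> n; rewrite (le_trans (fnorm_rscale _ _ _))// ler_wpM2r ?nA_ge0// fnorm_le_nH.
Qed.

Lemma nH0 : nH (0 : nat -> A) = 0.
Proof.
apply/le_anti; rewrite nH_ge0 andbT.
have := nH_rscale 0 (@HA0 R A); rewrite rscale0l => /le_trans; apply.
by rewrite nA0 mulr0.
Qed.

Lemma nH_le0 x : HA x -> nH x <= 0 -> x = 0.
Proof.
move=> hx x0; apply/funext => i; apply: (@nA_le0 _ A).
by apply: le_trans x0; exact: nA_coord_le.
Qed.

Lemma nHZ (r : R) x : HA x -> nH (r%:C *: x) <= `|r| * nH x.
Proof.
move=> hx; rewrite scale_rscale mulrC; apply: le_trans (nH_rscale _ hx) _.
rewrite ler_wpM2l ?nH_ge0//; have := nAZ r I1; rewrite {1}/GRing.scale/= => ->.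
by rewrite ler_piMr// nA1_le1.
Qed.

Lemma nHN x : HA x -> nH (- x) = nH x.
Proof.
suff le z : HA z -> nH (- z) <= nH z.
  move=> hx; apply/le_anti; rewrite le//=.
  by have := le _ (HAN hx); rewrite opprK.
move=> hz; rewrite -rscaleN1 (le_trans (nH_rscale _ hz))//.
by rewrite nAN ler_piMr ?nH_ge0// nA1_le1.
Qed.

Lemma nHC x y : HA x -> HA y -> nH (x - y) = nH (y - x).
Proof. by move=> hx hy; rewrite -nHN ?opprB//; exact: HAB. Qed.

Lemma nHB x y : HA x -> HA y -> nH (x - y) <= nH x + nH y.
Proof.
by move=> hx hy; rewrite -(nHN hy); apply: nHD => //; exact: HAN.
Qed.

Lemma nH_dist x y z : HA x -> HA y -> HA z ->
  nH (x - z) <= nH (x - y) + nH (y - z).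
Proof.
move=> hx hy hz; have -> : x - z = (x - y) + (y - z) by rewrite addrA subrK.
by apply: nHD; exact: HAB.
Qed.

Lemma nH_sum I (r : seq I) (P : pred I) (F : I -> nat -> A) :
  (forall i, HA (F i)) ->
  nH (\sum_(i <- r | P i) F i) <= \sum_(i <- r | P i) nH (F i).
Proof.
move=> hF; suff : HA (\sum_(i <- r | P i) F i) /\
  nH (\sum_(i <- r | P i) F i) <= \sum_(i <- r | P i) nH (F i) by case.
elim/big_ind2 : _ => [|x c y d [hx xc] [hy yd]|//]; rewrite ?nH0//.
  by split => //; exact: HA0.
by split; [exact: HAD|rewrite (le_trans (nHD _ _))// lerD].
Qed.

Lemma hin0r x : HA x -> hin x 0 = 0.
Proof.
move=> hx; have := hin_rscale (0 : cring A) hx (@HA0 R A).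
by rewrite rscale0l mulr0.
Qed.

Lemma hinDl x y z : HA x -> HA y -> HA z -> hin (x + y) z = hin x z + hin y z.
Proof.
move=> hx hy hz; rewrite -!(hin_star hz)//; last exact: HAD.
by rewrite hinDr// starD.
Qed.

Lemma hinNr x y : HA x -> HA y -> hin x (- y) = - hin x y.
Proof. by move=> hx hy; rewrite -rscaleN1 hin_rscale// mulrN1. Qed.

Lemma hinBr x y z : HA x -> HA y -> HA z -> hin x (y - z) = hin x y - hin x z.
Proof. by move=> hx hy hz; rewrite hinDr ?hinNr//; exact: HAN. Qed.

Lemma hin_sumr I (r : seq I) (P : pred I) x (F : I -> nat -> A) :
  HA x -> (forall i, HA (F i)) ->
  hin x (\sum_(i <- r | P i) F i) = \sum_(i <- r | P i) hin x (F i).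
Proof.
move=> hx hF; suff : HA (\sum_(i <- r | P i) F i) /\
  hin x (\sum_(i <- r | P i) F i) = \sum_(i <- r | P i) hin x (F i) by case.
elim/big_ind2 : _ => [|y c z d [hy yc] [hz zd]|//].
  by split; [exact: HA0|rewrite hin0r].
by split; [exact: HAD|rewrite hinDr// yc zd].
Qed.

Lemma hin_eq0 x : HA x -> (forall y, HA y -> hin y x = 0) -> x = 0.
Proof.
by move=> hx x0; apply: nH_le0 => //; rewrite nH_leE// x0// nA0 expr0n.
Qed.

Lemma fnorm_cons i (s : seq nat) x : fnorm (i :: s) x <= nA (x i) + fnorm s x.
Proof.
rewrite -(@ler_pXn2r _ 2)// ?nnegrE ?addr_ge0 ?fnorm_ge0 ?nA_ge0//.
rewrite fnorm2 /fip big_cons sqrrD fnorm2 (le_trans (nAD _ _))// nA_cstar.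
by rewrite lerD2r lerDl mulrn_wge0// mulr_ge0 ?nA_ge0 ?fnorm_ge0.
Qed.

Lemma fnorm_tends (u : nat -> nat -> A) x (s : seq nat) (e : R) :
  (forall i, tends (fun k => u k i) (x i)) -> 0 < e ->
  exists N, forall k, (N <= k)%N -> fnorm s (x - u k) <= e.
Proof.
move=> ux; elim: s e => [|i s IH] e e0.
  by exists 0%N => k _; rewrite /fnorm /fip big_nil nA0 sqrtr0 ltW.
have e2 : 0 < e / 2 by rewrite divr_gt0.
have [N Ns] := IH _ e2; have [M Mi] := ux i _ e2.
exists (maxn N M) => k; rewrite geq_max => /andP[Nk Mk].
rewrite (le_trans (fnorm_cons _ _ _))// [X in _ <= X](splitr e) lerD//; last exact: Ns.
exact: Mi.
Qed.

(** The coordinates converge, and the bounds on windows of indices pass to the limit one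
    window at a time. *)
Lemma HA_complete (u : nat -> nat -> A) (eta : nat -> R) :
  (forall k, HA (u k)) ->
  (forall k j, (k <= j)%N -> nH (u j - u k) <= eta k) ->
  (forall e, 0 < e -> exists k, eta k <= e) ->
  exists x, HA x /\ forall k, nH (x - u k) <= eta k.
Proof.
move=> hu uC eta0.
have /choice[x ux] i : exists l, tends (fun k => u k i : cring A) l.
  have [k j kj|l ul _] := @cring_complete _ _ (fun k => u k i) _ _ eta0.
    apply: le_trans (uC _ _ kj); apply: (@nA_coord_le _ _ (u j - u k)).
    exact: HAB.
  by exists l.
have xu (s : seq nat) k : (forall j, (k <= j)%N -> fnorm s (u j - u k) <= eta k) ->
    fnorm s (x - u k) <= eta k.
  move=> sk; apply: le_of_forall_eps => e e0; have [N Ns] := fnorm_tends s ux e0.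
  have := Ns _ (leq_maxl N k); have := sk _ (leq_maxr N k).
  set v := u (maxn _ _) => h1 h2.
  have -> : x - u k = (x - v) + (v - u k) by rewrite addrA subrK.
  by rewrite (le_trans (fnormD _ _ _))// addrC lerD.
have {}xu m n k : fnorm (iota_ m n) (x - u k) <= eta k.
  apply: xu => j kj; apply: le_trans (uC _ _ kj).
  by apply: fnorm_le_nH; exact: HAB.
have hx : HA x.
  apply/HA_cauchyP => e e0; have e2 : 0 < e / 2 by rewrite divr_gt0.
  have [k ke] := eta0 _ e2; have /HA_cauchyP /(_ _ e2)[N Nu] := hu k.
  exists N => m n Nm mn; rewrite -(subrK (u k) x).
  rewrite (le_trans (fnormD _ _ _))// [X in _ <= X]splitr lerD//; last exact: Nu.
  exact: le_trans (xu _ _ _) ke.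
exists x; split => // k; apply: nH_le_fnorm; first exact: HAB.
  by rewrite (le_trans (nH_ge0 _) (uC _ _ (leqnn k))).
by move=> n; exact: xu.
Qed.

End ModuleArith.
(** * Module maps and the contraction principle *)

Section Operators.
Context {R : realType} {A : cstarAlgType R}.
Implicit Types (x y z : nat -> A) (a b : cring A).
Local Notation op := ((nat -> A) -> (nat -> A)).
Implicit Types (T S : op).
Local Notation I1 := (1 : cring A).

Definition module_map T : Prop :=
  set_fun HA HA T /\ Alinear_on HA T.

Lemma bounded_onP (M : set (nat -> A)) T : bounded_on M T <->
  exists2 c : R, 0 <= c & forall x, M x -> nH (T x) <= c * nH x.
Proof.
split=> [[c cT]|[c c0 cT]]; last first.
  by exists c%:C => x /cT; rewrite !hnormE -rmorphM/= lecR.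
exists `|complex.Re c| => // x /cT; rewrite !hnormE lecE => /andP[_ /=].
rewrite (_ : complex.Re _ = complex.Re c * nH x); last first.
  by case: c {cT} => a b /=; rewrite mulr0 subr0.
by move=> /le_trans; apply; rewrite ler_wpM2r ?nH_ge0// ler_norm.
Qed.

Section Map.
Variable T : op.
Hypothesis mT : module_map T.

Lemma map_HA x : HA x -> HA (T x). Proof. by case: mT => h _; apply: h. Qed.

Lemma mapD x y : HA x -> HA y -> T (x + y) = T x + T y.
Proof.
case: mT => _ lT hx hy.
by have := lT x y I1 hx hy; rewrite !rscale1.
Qed.

Lemma map0 : T 0 = 0.
Proof.
by apply: (addrI (T 0)); rewrite addr0 -mapD ?addr0//; exact: HA0.
Qed.

Lemma map_rscale x a : HA x -> T (rscale x a) = rscale (T x) a.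
Proof.
case: mT => _ lT hx.
by have := lT x 0 a hx (@HA0 R A); rewrite !addr0 map0 addr0.
Qed.

Lemma mapN x : HA x -> T (- x) = - T x.
Proof. by move=> hx; rewrite -!rscaleN1 map_rscale. Qed.

Lemma mapB x y : HA x -> HA y -> T (x - y) = T x - T y.
Proof. by move=> hx hy; rewrite mapD ?mapN//; exact: HAN. Qed.

Lemma mapZ (c : R[i]) x : HA x -> T (c *: x) = c *: T x.
Proof. by move=> hx; rewrite !scale_rscale map_rscale. Qed.

Lemma map_sum I (r : seq I) (P : pred I) (F : I -> nat -> A) :
  (forall i, HA (F i)) ->
  T (\sum_(i <- r | P i) F i) = \sum_(i <- r | P i) T (F i).
Proof.
move=> hF; suff : HA (\sum_(i <- r | P i) F i) /\
  T (\sum_(i <- r | P i) F i) = \sum_(i <- r | P i) T (F i) by case.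
elim/big_ind2 : _ => [|y c z d [hy yc] [hz zd]|//].
  by split; [exact: HA0|rewrite map0].
by split; [exact: HAD|rewrite mapD// yc zd].
Qed.

End Map.

Lemma hclosed_limit (M : set (nat -> A)) x : hclosed M -> HA x ->
  (forall e : R, 0 < e -> exists2 y, M y & nH (x - y) <= e) -> M x.
Proof.
move=> cM hx xM; apply: cM => // e e0.
have re0 : 0 < complex.Re e by rewrite -ltcR RRe_real ?gtr0_real.
have [|y My xy] := xM (complex.Re e / 2); first by rewrite divr_gt0.
exists y => //; rewrite hnormE -(RRe_real (gtr0_real e0)) ltcR.
by rewrite (le_lt_trans xy)// ltr_pdivrMr// ltr_pMr// ltr1n.
Qed.

Lemma hclosed_intro (M : set (nat -> A)) :
  (forall x, HA x ->
    (forall e : R, 0 < e -> exists2 y, M y & nH (x - y) <= e) -> M x) ->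
  hclosed M.
Proof.
move=> cM x hx xM; apply: cM => // e e0.
have [|y My] := xM e%:C; first by rewrite ltcR.
by rewrite hnormE ltcR => /ltW xy; exists y.
Qed.

Lemma nH_eq_small x y : HA x -> HA y ->
  (forall e : R, 0 < e -> nH (x - y) <= e) -> x = y.
Proof.
move=> hx hy xy; apply/eqP; rewrite -subr_eq0; apply/eqP.
apply: nH_le0; first exact: HAB.
by apply: le_of_forall_eps => e /xy; rewrite add0r.
Qed.

Lemma HA_geometric (u : nat -> nat -> A) (C : R) :
  (forall k, HA (u k)) -> 0 <= C ->
  (forall k, nH (u k.+1 - u k) <= C * 2^-1 ^+ k) ->
  exists x, HA x /\ forall k, nH (x - u k) <= 2 * C * 2^-1 ^+ k.
Proof.
move=> hu C0 uC.
apply: (HA_complete hu) => [k j kj|e e0]; last first.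
  by apply: geometric_small => //; lra.
have -> : 2 * C = C / (1 - 2^-1).
  by rewrite mulrC; congr (_ * _); apply/esym/(canLR (@invrK _)); lra.
apply: (@geometric_dist _ (fun k j => nH (u j - u k))) => //.
- lra.
- by move=> i; rewrite subrr nH0.
- by move=> k' j'; rewrite [X in _ <= X]addrC; exact: nH_dist.
Qed.

Lemma half_pow_small (C e : R) : 0 < e -> exists k, C * 2^-1 ^+ k <= e.
Proof. by move=> e0; apply: geometric_small => //; lra. Qed.

Lemma contraction_fixpoint (g : op) : set_fun HA HA g ->
  (forall x y, HA x -> HA y -> nH (g x - g y) <= 2^-1 * nH (x - y)) ->
  exists x, HA x /\ g x = x.
Proof.
move=> gH gC; pose u n := iter n g 0.
have hu n : HA (u n) by elim: n => [|n IH]; [exact: HA0|exact: gH].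
have [|||x [hx xu]] := @HA_geometric u (nH (u 1%N)).
- exact: hu.
- exact: nH_ge0.
- elim=> [|k IH]; first by rewrite subr0 mulr1.
  rewrite exprS mulrCA; apply: le_trans (gC _ _ (hu k.+1) (hu k)) _.
  by rewrite ler_pM2l.
exists x; split => //; apply: nH_eq_small => //; first exact: gH.
move=> e e0.
have e2 : 0 < e / 2 by rewrite divr_gt0.
have [k ke] := half_pow_small (2 * nH (u 1%N)) e2.
have hk := le_trans (xu k) ke.
have hk1 : nH (x - u k.+1) <= e / 2.
  apply: le_trans (xu _) (le_trans _ ke).
  rewrite ler_wpM2l ?mulr_ge0 ?nH_ge0// exprS ler_piMl ?exprn_ge0//; lra.
apply: le_trans (nH_dist (gH _ hx) (hu k.+1) hx) _.
have := gC _ _ hx (hu k); rewrite [nH (u k.+1 - x)]nHC// -[g (u k)]/(u k.+1).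
lra.
Qed.

End Operators.
(** * The open mapping theorem *)

Section OpenMapping.
Context {R : realType} {A : cstarAlgType R}.
Implicit Types (x y z m u : nat -> A).
Variables (M D : set (nat -> A)) (T : (nat -> A) -> (nat -> A)).
Hypotheses (cM : closed_submodule M) (cD : closed_submodule D).
Hypotheses (mT : module_map T) (bT : bounded_on HA T).

(** The image of a ball under the map taking [(m, u)] to [m + T u] on the product of [M]
    and [D]. *)
Definition sum_ball (t : R) : set (nat -> A) :=
  [set z | exists m u, [/\ M m, D u, z = m + T u, nH m <= t & nH u <= t]].

Lemma submod_HA (N : set (nat -> A)) x : closed_submodule N -> N x -> HA x.
Proof. by case=> sN _ _ _ _ /sN. Qed.

Lemma submodZ (N : set (nat -> A)) (c : R[i]) x :
  closed_submodule N -> N x -> N (c *: x).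
Proof. by case=> _ _ _ NZ _ Nx; rewrite scale_rscale; exact: NZ. Qed.

Lemma submodB (N : set (nat -> A)) x y :
  closed_submodule N -> N x -> N y -> N (x - y).
Proof.
move=> cN Nx Ny; rewrite -rscaleN1; case: cN => _ _ ND NZ _.
by apply: ND => //; exact: NZ.
Qed.

Lemma submod_sum (N : set (nat -> A)) k (f : 'I_k -> nat -> A) :
  closed_submodule N -> (forall i, N (f i)) -> N (\sum_(i < k) f i).
Proof. by case=> _ N0 ND _ _ Nf; apply: big_ind. Qed.

Lemma sum_ball_le s t z : s <= t -> sum_ball s z -> sum_ball t z.
Proof.
move=> st [m [u [Mm Du zE ms us]]]; exists m, u; split=> //.
- exact: le_trans st.
- exact: le_trans st.
Qed.

Lemma sum_ball_HA t z : sum_ball t z -> HA z.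
Proof.
move=> [m [u [Mm Du -> _ _]]]; apply: HAD; first exact: submod_HA Mm.
by apply: map_HA => //; exact: submod_HA Du.
Qed.

Lemma sum_ballB s t y z : sum_ball s y -> sum_ball t z -> sum_ball (s + t) (y - z).
Proof.
move=> [m [u [Mm Du -> ms us]]] [m' [u' [Mm' Du' -> mt ut]]].
have [hm hm'] := (submod_HA cM Mm, submod_HA cM Mm').
have [hu hu'] := (submod_HA cD Du, submod_HA cD Du').
exists (m - m'), (u - u'); split.
- exact: submodB.
- exact: submodB.
- by rewrite mapB// opprD addrACA.
- by rewrite (le_trans (nHB _ _))// lerD.
- by rewrite (le_trans (nHB _ _))// lerD.
Qed.

Lemma sum_ballZ (c t : R) z : 0 <= c -> sum_ball t z -> sum_ball (c * t) (c%:C *: z).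
Proof.
move=> c0 [m [u [Mm Du -> mt ut]]].
have [hm hu] := (submod_HA cM Mm, submod_HA cD Du).
exists (c%:C *: m), (c%:C *: u); split.
- exact: submodZ.
- exact: submodZ.
- by rewrite mapZ// scalerDr.
- by rewrite (le_trans (nHZ _ _))// ger0_norm// ler_wpM2l.
- by rewrite (le_trans (nHZ _ _))// ger0_norm// ler_wpM2l.
Qed.

Hypothesis sumT : forall z, HA z -> exists m u, [/\ M m, D u & z = m + T u].

(** Baire's argument: otherwise there are shrinking balls, the [k]-th of which avoids
    [sum_ball k], and their common point lies in no [sum_ball]. *)
Lemma sum_ball_somewhere_dense : exists (k : nat) x0 (r : R),
  [/\ HA x0, 0 < r & forall x, HA x -> nH (x - x0) <= r ->
    forall e : R, 0 < e -> exists2 y, sum_ball k%:R y & nH (x - y) <= e].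
Proof.
apply: contrapT => nex.
have /choice[f fP] (p : nat * ((nat -> A) * R)) : exists q : (nat -> A) * R,
    HA p.2.1 -> 0 < p.2.2 -> [/\ HA q.1, nH (q.1 - p.2.1) <= p.2.2, 0 < q.2
      & forall y, sum_ball p.1%:R y -> q.2 < nH (q.1 - y)].
  case: p => k [x0 r] /=.
  have [[hx0 r0]|nh] := pselect (HA x0 /\ 0 < r); last first.
    by exists (0, 0) => hx0 r0; case: nh.
  apply: contrapT => H; apply: nex; exists k, x0, r; split => // x hx xr e e0.
  apply: contrapT => H2; apply: H; exists (x, e) => _ _; split => //= y ky.
  by rewrite ltNge; apply/negP => xy; apply: H2; exists y.
(* The halved radius leaves room for all later steps inside the current ball. *)
pose next k (s : (nat -> A) * R) :=
  let q := f (k, (s.1, s.2 / 2)) in (q.1, Num.min (s.2 / 2) q.2).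
pose st := fix st k := if k is j.+1 then next j (st j) else ((0 : nat -> A), 1 : R).
pose x k := (st k).1; pose r k := (st k).2.
have xr k : HA (x k) /\ 0 < r k.
  elim: k => [|k [hx r0]]; first by split; [exact: HA0|exact: ltr01].
  have r2 : 0 < r k / 2 by rewrite divr_gt0.
  have [h1 h2 h3 h4] := fP (k, (x k, r k / 2)) hx r2.
  by split; rewrite /x /r /= -/(x k) -/(r k)// lt_min h3 r2.
have step k : [/\ nH (x k.+1 - x k) <= r k / 2, r k.+1 <= r k / 2
    & forall y, sum_ball k%:R y -> r k.+1 < nH (x k.+1 - y)].
  have [hx r0] := xr k; have r2 : 0 < r k / 2 by rewrite divr_gt0.
  have [h1 h2 h3 h4] := fP (k, (x k, r k / 2)) hx r2.
  split; [exact: h2|by rewrite /r /= ge_min lexx|].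
  by move=> y /h4; apply: le_lt_trans; rewrite /r /= ge_min lexx orbT.
have rpow k : r k <= 1 * 2^-1 ^+ k.
  elim: k => [|k IH]; first by rewrite mulr1.
  by have [_ h _] := step k; rewrite exprS; lra.
have xC k j : (k <= j)%N -> nH (x j - x k) <= r k.
  move=> /subnKC <-; suff : nH (x (k + (j - k))%N - x k) <= r k - r (k + (j - k))%N.
    by have [_] := xr (k + (j - k))%N; lra.
  elim: (j - k)%N => [|i IH]; first by rewrite addn0 !subrr nH0.
  have [hk _] := xr k; have [hi _] := xr (k + i)%N; have [hi1 _] := xr (k + i).+1.
  rewrite addnS; have [h1 h2 _] := step (k + i)%N.
  by have := nH_dist hi1 hi hk; lra.
have [e e0|l [hl xl]] := HA_complete (fun k => (xr k).1) xC.
  have [k ke] := half_pow_small 1 e0; exists k; exact: le_trans (rpow k) ke.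
have [m [u [Mm Du lE]]] := sumT hl.
(* The limit has a representation [m + T u]; stage [K] of the construction excludes it. *)
pose K := Num.bound (nH m + nH u).
have [_ _ /(_ l)] := step K.
have mu : nH m + nH u < K%:R by apply: archi_boundP; rewrite addr_ge0 ?nH_ge0.
have Kl : sum_ball K%:R l.
  by exists m, u; split => //; have := nH_ge0 m; have := nH_ge0 u; lra.
by move=> /(_ Kl); rewrite nHC ?ltNge ?xl//; case: (xr K.+1).
Qed.

(** A small vector is the difference of two vectors near the centre found by Baire's
    argument; scaling reaches all vectors. *)
Lemma sum_ball_dense : exists2 C : R, 0 < C & forall z s, HA z -> 0 < s ->
  nH z <= s -> forall e : R, 0 < e ->
  exists2 y, sum_ball (C * s) y & nH (z - y) <= e.
Proof.
have [k [x0 [r [hx0 r0 x0D]]]] := sum_ball_somewhere_dense.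
exists ((k + k).+1%:R / r); first by rewrite divr_gt0.
move=> z s hz s0 zs e e0.
have rs0 : 0 < r / s by rewrite divr_gt0.
have sr0 : 0 < s / r by rewrite divr_gt0.
pose z' := (r / s)%:C *: z.
have hz' : HA z' by exact: HAZ.
have z'r : nH z' <= r.
  apply: le_trans (nHZ _ hz) _; rewrite gtr0_norm//.
  by rewrite mulrAC ler_pdivrMr// ler_pM2l.
have e2 : 0 < e * (r / s) / 2 by rewrite divr_gt0// mulr_gt0.
(* [z'] is the difference of [x0 + z'] and [x0], both close to [sum_ball k]. *)
have [|y1 y1k y1z] := x0D (x0 + z') (HAD hx0 hz') _ _ e2.
  by rewrite addrAC subrr add0r.
have [|y2 y2k y2z] := x0D x0 hx0 _ _ e2; first by rewrite subrr nH0 ltW.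
have hy1 := sum_ball_HA y1k; have hy2 := sum_ball_HA y2k.
exists ((s / r)%:C *: (y1 - y2)).
  apply: sum_ball_le (sum_ballZ (ltW sr0) (sum_ballB y1k y2k)).
  rewrite -natrD [X in _ <= X]mulrAC -mulrA [X in _ <= X]mulrC ler_pM2l//.
  by rewrite ler_nat.
have -> : z = (s / r)%:C *: z'.
  rewrite scalerA -rmorphM/= mulrA divfK ?gt_eqF// divff ?gt_eqF//.
  by rewrite rmorph1 scale1r.
rewrite -scalerBr; apply: le_trans (nHZ _ _) _; first by apply: HAB => //; exact: HAB.
rewrite gtr0_norm// -ler_pdivlMl// invf_div mulrC.
have -> : z' - (y1 - y2) = (x0 + z' - y1) - (x0 - y2).
  rewrite !opprB [x0 + z']addrC -!addrA [- y1 + (_ + _)]addrA.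
  by rewrite [x0 + (_ - x0)]addrC subrK [y2 - y1]addrC.
apply: le_trans (nHB _ _) _; [|exact: HAB|]; first by apply: HAB => //; exact: HAD.
lra.
Qed.

(** The open mapping theorem for [m + T u].  Approximations with errors that are halved
    at each step are summed up to an exact representation. *)
Lemma sum_ball_open : exists2 C : R, 0 < C &
  forall z s, HA z -> 0 < s -> nH z <= s -> sum_ball (C * s) z.
Proof.
have [C C0 dense] := sum_ball_dense.
exists (2 * C); first by rewrite mulr_gt0.
move=> z s hz s0 zs.
have hn k : 0 < s * 2^-1 ^+ k by rewrite mulr_gt0// exprn_gt0// invr_gt0.
have /choice[f fP] (p : nat * (nat -> A)) : exists q : (nat -> A) * (nat -> A),
    HA p.2 -> nH p.2 <= s * 2^-1 ^+ p.1 ->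
    [/\ M q.1, D q.2, nH q.1 <= C * (s * 2^-1 ^+ p.1),
      nH q.2 <= C * (s * 2^-1 ^+ p.1)
      & nH (p.2 - (q.1 + T q.2)) <= s * 2^-1 ^+ p.1.+1].
  case: p => k w /=; have [[hw ws]|nh] := pselect (HA w /\ nH w <= s * 2^-1 ^+ k).
    have [_ [m [u [Mm Du -> mC uC]]] wmu] := dense _ _ hw (hn k) ws _ (hn k.+1).
    by exists (m, u).
  by exists (0, 0) => hw ws; case: nh.
(* [w k] is the error left after [k] corrections [dm] and [du]. *)
pose w := fix w k := if k is j.+1 then
  w j - ((f (j, w j)).1 + T (f (j, w j)).2) else z.
pose dm k := (f (k, w k)).1; pose du k := (f (k, w k)).2.
have wS k : w k.+1 = w k - (dm k + T (du k)) by [].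
have wP k : HA (w k) /\ nH (w k) <= s * 2^-1 ^+ k.
  elim: k => [|k [hw ws]]; first by rewrite mulr1.
  have [Mm Du _ _ wk] := fP (k, w k) hw ws; split; last exact: wk.
  rewrite wS; apply: HAB => //; apply: HAD; first exact: submod_HA Mm.
  by apply: map_HA => //; exact: submod_HA Du.
have dP k : [/\ M (dm k), D (du k), nH (dm k) <= C * s * 2^-1 ^+ k
    & nH (du k) <= C * s * 2^-1 ^+ k].
  by have [hw ws] := wP k; have [? ? ? ? _] := fP (k, w k) hw ws; rewrite -!mulrA.
have Mdm k : M (dm k) by case: (dP k).
have Ddu k : D (du k) by case: (dP k).
pose ms k := \sum_(i < k) dm i; pose us k := \sum_(i < k) du i.
have Mms k : M (ms k) by exact: submod_sum.
have Dus k : D (us k) by exact: submod_sum.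
have hms k := submod_HA cM (Mms k); have hus k := submod_HA cD (Dus k).
have zE k : z = w k + (ms k + T (us k)).
  elim: k => [|k IH]; first by rewrite /ms /us !big_ord0 map0// !addr0.
  rewrite wS /ms /us !big_ord_recr -/(ms k) -/(us k) (mapD mT (hus k) (submod_HA cD (Ddu k))).
  rewrite {1}IH [in RHS](addrACA (ms k)) [_ + (dm k + _)]addrC.
  by rewrite [RHS]addrA subrK.
have Cs0 : 0 <= C * s by rewrite mulr_ge0// ltW.
have [|||m [hm msm]] := @HA_geometric _ _ ms (C * s).
- exact: hms.
- exact: Cs0.
- by move=> k; rewrite /ms big_ord_recr/= addrAC subrr add0r; case: (dP k).
have [|||u [hu usu]] := @HA_geometric _ _ us (C * s).
- exact: hus.
- exact: Cs0.
- by move=> k; rewrite /us big_ord_recr/= addrAC subrr add0r; case: (dP k).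
have Mm : M m.
  case: (cM) => _ _ _ _ Mcl; apply: (hclosed_limit Mcl hm) => e e0.
  have [k ke] := half_pow_small (2 * (C * s)) e0.
  by exists (ms k); [|exact: le_trans ke].
have Du : D u.
  case: (cD) => _ _ _ _ Dcl; apply: (hclosed_limit Dcl hu) => e e0.
  have [k ke] := half_pow_small (2 * (C * s)) e0.
  by exists (us k); [|exact: le_trans ke].
exists m, u; split => //.
- apply: nH_eq_small => //; first by apply: HAD => //; exact: map_HA.
  move=> e e0; have /bounded_onP[c c0 Tc] := bT.
  have [k ke] := half_pow_small (s + 2 * (C * s) + c * (2 * (C * s))) e0.
  have [hw ws] := wP k; rewrite {1}(zE k).
  have -> : w k + (ms k + T (us k)) - (m + T u) = w k - (m - ms k) - T (u - us k).
    rewrite (mapB mT hu (hus k)) !opprB opprD -!addrA.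
    by rewrite [T (us k) + (- m + _)]addrCA.
  have hmk := HAB hm (hms k); have huk := HAB hu (hus k).
  apply: le_trans (nHB (HAB hw hmk) (map_HA mT huk)) _.
  have := nHB hw hmk; have := Tc _ huk; have := msm k.
  have := ler_wpM2l c0 (usu k); nra.
- by have := msm 0%N; rewrite /ms big_ord0 subr0 mulr1 mulrA.
- by have := usu 0%N; rewrite /us big_ord0 subr0 mulr1 mulrA.
Qed.

End OpenMapping.
(** * Bounded module maps *)

Section BoundedMaps.
Context {R : realType} {A : cstarAlgType R}.
Implicit Types (x y z : nat -> A) (a b : cring A).
Local Notation op := ((nat -> A) -> (nat -> A)).
Implicit Types (F T S V D K E : op).
Local Notation I1 := (1 : cring A).
Local Notation iota_ := index_iota.

Definition bmap T := module_map T /\ bounded_on HA T.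

Lemma Ba_bmap T : Ba T -> bmap T.
Proof. by case. Qed.

Lemma bmap_bound T : bmap T -> exists2 c : R, 0 <= c &
  forall x, HA x -> nH (T x) <= c * nH x.
Proof. by case=> _ /bounded_onP. Qed.

Lemma bmap_comp S T : bmap S -> bmap T -> bmap (S \o T).
Proof.
move=> bS bT; have [mS _] := bS; have [mT _] := bT; split; first split.
- by move=> x /(map_HA mT) /(map_HA mS).
- move=> x y a hx hy /=; rewrite (proj2 mT _ _ a hx hy).
  by apply: (proj2 mS); exact: map_HA.
have [c c0 cS] := bmap_bound bS; have [d d0 dT] := bmap_bound bT.
apply/bounded_onP; exists (c * d); first exact: mulr_ge0.
move=> x hx; apply: le_trans (cS _ (map_HA mT hx)) _.
by rewrite -mulrA ler_wpM2l// dT.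
Qed.

Lemma bmap_id : bmap id.
Proof.
split; first by split.
by apply/bounded_onP; exists 1 => // x _; rewrite mul1r.
Qed.

Lemma bmap_cst0 : bmap (fun=> 0).
Proof.
split; first split.
- by move=> x _; exact: HA0.
- by move=> x y a _ _; rewrite addr0 rscale0l.
by apply/bounded_onP; exists 0 => // x _; rewrite nH0 mul0r.
Qed.

Lemma closed_equalizer S T : bmap S -> bmap T ->
  closed_submodule [set x | HA x /\ S x = T x].
Proof.
move=> bS bT; have [mS _] := bS; have [mT _] := bT; split.
- by move=> x [].
- by split; [exact: HA0|rewrite (map0 mS) (map0 mT)].
- by move=> x y [hx xE] [hy yE]; split; [exact: HAD|rewrite (mapD mS)// (mapD mT)// xE yE].
- by move=> x a [hx xE]; split; [exact: HA_rscale|rewrite (map_rscale mS)// (map_rscale mT)// xE].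
apply: hclosed_intro => x hx xM; split => //.
have [c c0 cS] := bmap_bound bS; have [d d0 dT] := bmap_bound bT.
apply: nH_eq_small; [exact: map_HA|exact: map_HA|] => e e0.
have cd1 : 0 < c + d + 1 by lra.
have [|y [hy yE] xy] := xM (e / (c + d + 1)); first by rewrite divr_gt0.
have -> : S x - T x = S (x - y) - T (x - y).
  by rewrite (mapB mS)// (mapB mT)// yE opprB addrA subrK.
have hxy := HAB hx hy.
apply: le_trans (nHB (map_HA mS hxy) (map_HA mT hxy)) _.
move: xy; rewrite ler_pdivlMr// => xy.
have := cS _ hxy; have := dT _ hxy; have := nH_ge0 (x - y); nra.
Qed.

Lemma idempotent_direct_sum E : bmap E ->
  (forall x, HA x -> E (E x) = E x) ->
  direct_sum [set x | HA x /\ E x = x] [set x | HA x /\ E x = 0].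
Proof.
move=> bE EE; have [mE _] := bE; split.
- exact: closed_equalizer bE bmap_id.
- exact: closed_equalizer bE bmap_cst0.
- apply/seteqP; split=> [x [[_ Ex] [_ Ex0]]|x ->]; first exact: etrans (esym Ex) Ex0.
  by split; split; rewrite ?(map0 mE)//; exact: HA0.
apply/seteqP; split=> [_ [x [hx _]] [y [hy _]] <-|x hx]; first exact: HAD.
have hEx := map_HA mE hx.
exists (E x); first by split; rewrite ?EE.
exists (x - E x); last by rewrite addrC subrK.
by split; [exact: HAB|rewrite (mapB mE)// EE// subrr].
Qed.

Lemma bmap_inverse T (C : R) : module_map T -> 0 <= C ->
  (forall x, HA x -> nH x <= C * nH (T x)) ->
  (forall y, HA y -> exists x, HA x /\ T x = y) ->
  exists S, [/\ bmap S, forall y, HA y -> nH (S y) <= C * nH y,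
    forall y, HA y -> T (S y) = y & forall x, HA x -> S (T x) = x].
Proof.
move=> mT C0 Tlow Tsurj.
have Tinj x y : HA x -> HA y -> T x = T y -> x = y.
  move=> hx hy Txy; apply/eqP; rewrite -subr_eq0; apply/eqP.
  apply: nH_le0; first exact: HAB.
  apply: le_trans (Tlow _ (HAB hx hy)) _.
  by rewrite (mapB mT)// Txy subrr nH0 mulr0.
have /choice[S SP] y : exists x, HA y -> HA x /\ T x = y.
  have [hy|nhy] := pselect (HA y); last by exists 0 => /nhy.
  by have [x xP] := Tsurj y hy; exists x.
have hS y : HA y -> HA (S y) by case/SP.
have TS y : HA y -> T (S y) = y by case/SP.
have Sle y : HA y -> nH (S y) <= C * nH y.
  by move=> hy; rewrite -{2}(TS y hy); apply: Tlow; exact: hS.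
exists S; split=> //; last by move=> x hx; have hTx := map_HA mT hx; apply: Tinj; rewrite ?TS//; exact: hS.
split; last by apply/bounded_onP; exists C.
split=> [y /hS//|x y a hx hy].
have [hSx hSy] := (hS _ hx, hS _ hy); have hxa := @HA_rscale _ _ _ a hx.
have hSa := @HA_rscale _ _ _ a hSx.
apply: Tinj; [exact/hS/HAD|exact: HAD|].
by rewrite (mapD mT)// (map_rscale mT)// !TS//; exact: HAD.
Qed.

(** * Compact operators are small on tails *)

Definition tail n x : nat -> A := fun i => if (i < n)%N then 0 else x i.

Lemma fnorm_tail_le n (s : seq nat) x : fnorm s (tail n x) <= fnorm s x.
Proof.
rewrite ler_sqrt ?nA_ge0//.
pose h := x - tail n x.
suff -> : fip s x x = fip s (tail n x) (tail n x) + fip s h h.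
  by apply: nA_mono; exact: pos_fip.
rewrite /fip -big_split; apply: eq_bigr => i _ /=.
have -> : h i = (if (i < n)%N then x i else 0).
  have -> : h i = x i - tail n x i by [].
  by rewrite /tail; case: ifP => _; rewrite ?subr0 ?subrr.
by rewrite /tail; case: ifP => _; rewrite (@mulr0 (cring A)) ?add0r ?addr0.
Qed.

Lemma HA_tail n x : HA x -> HA (tail n x).
Proof.
move=> /HA_cauchyP xC; apply/HA_cauchyP => e /xC[N Nx]; exists N => k j Nk kj.
exact: le_trans (fnorm_tail_le _ _ _) (Nx _ _ Nk kj).
Qed.

Lemma nH_tail_le n x : HA x -> nH (tail n x) <= nH x.
Proof.
move=> hx; apply: nH_le_fnorm; [exact: HA_tail|exact: nH_ge0|] => k.
by apply: le_trans (fnorm_tail_le _ _ _) _; exact: fnorm_le_nH.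
Qed.

Lemma tail_tail n k x : (k <= n)%N -> tail n (tail k x) = tail n x.
Proof.
move=> kn; apply/funext => i; rewrite /tail; case: ifP => // /negbT.
by rewrite -leqNgt => ni; rewrite ltnNge (leq_trans kn ni).
Qed.

Lemma tail_small x (e : R) : HA x -> 0 < e -> exists N, forall n, (N <= n)%N ->
  nH (tail n x) <= e.
Proof.
move=> hx e0; have /HA_cauchyP /(_ _ e0)[N Nx] := hx; exists N => n Nn.
rewrite -(tail_tail x Nn).
apply: le_trans (nH_tail_le n (HA_tail hx)) _.
apply: nH_le_fnorm; [exact: HA_tail|exact: ltW|] => k.
apply: le_trans (Nx N (maxn N k) (leqnn N) (leq_maxl _ _)).
rewrite ler_sqrt ?nA_ge0//.
apply: le_trans (fip_range_mono (tail N x) (leq0n k) (leq_maxr N k)) _.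
rewrite /fip (big_cat_nat (leq0n N) (leq_maxl N k))/= big_nat big1 ?add0r.
  rewrite big_nat [X in _ <= nA X]big_nat.
  rewrite (eq_bigr (fun i => star (x i) * x i))// => i /andP[Ni _].
  by rewrite /tail ltnNge Ni.
by move=> i /andP[_ iN]; rewrite /tail iN mulr0.
Qed.

Lemma bmap_tail n : bmap (tail n).
Proof.
split; first split.
- by move=> x; exact: HA_tail.
- move=> x y a _ _; apply/funext => i; rewrite /tail /rscale !fctE.
  by case: ifP => // _; rewrite addr0; apply: esym; exact: (@mul0r (cring A)).
by apply/bounded_onP; exists 1 => // x hx; rewrite mul1r nH_tail_le.
Qed.

Lemma hin_tail n x y : HA x -> HA y -> hin x (tail n y) = hin (tail n x) y.
Proof.
move=> hx hy; apply: (tends_unique (tends_hinner hx (HA_tail hy))).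
have -> : (fun k => fip (iota_ 0 k) x (tail n y)) =
    fun k => fip (iota_ 0 k) (tail n x) y.
  apply/funext => k; apply: eq_bigr => i _; rewrite /tail.
  by case: ifP => // _; rewrite star0 mulr0 mul0r.
by apply: tends_hinner => //; exact: HA_tail.
Qed.

Lemma nH_theta_tail n x y z : HA x -> HA y -> HA z ->
  nH (theta x y (tail n z)) <= nH x * nH (tail n y) * nH z.
Proof.
move=> hx hy hz; apply: le_trans (nH_rscale _ hx) _.
rewrite -mulrA ler_wpM2l ?nH_ge0// -/(hin y (tail n z)) hin_tail//.
by apply: nA_hin_le => //; exact: HA_tail.
Qed.

Lemma finite_rank_tail_small S (e : R) : finite_rank S -> 0 < e ->
  exists n, forall z, HA z -> nH (S (tail n z)) <= e * nH z.
Proof.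
move=> [k [c [x [y [hxy SE]]]]] e0.
pose w i := nA (c i *: (1 : cring A) : A) * nH (x i).
have w0 i : 0 <= w i by rewrite mulr_ge0 ?nA_ge0 ?nH_ge0.
pose B := \sum_(i < k) w i; have B0 : 0 <= B by rewrite sumr_ge0.
have eB0 : 0 < e / (B + 1) by rewrite divr_gt0//; lra.
have /choice[N NP] i : exists N, forall n, (N <= n)%N ->
    nH (tail n (y i)) <= e / (B + 1).
  by apply: tail_small => //; case: (hxy i).
exists (\max_(i < k) N i) => z hz; set n := \max_(i < k) N i.
have htz := @HA_tail n _ hz; rewrite SE//.
have hth i : HA (theta (x i) (y i) (tail n z)).
  by apply: HA_rscale; case: (hxy i).
apply: le_trans (nH_sum _ _ _) _; first by move=> i; exact: HAZ.
apply: le_trans (_ : \sum_(i < k) w i * (e / (B + 1)) * nH z <= _).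
  apply: ler_sum => i _; have [hxi hyi] := hxy i.
  rewrite scale_rscale; apply: le_trans (nH_rscale _ (hth i)) _.
  have := nH_theta_tail n hxi hyi hz.
  have := NP i n (leq_bigmax _).
  set q := nA _; have q0 : 0 <= q := nA_ge0 _.
  move=> h1 h2; rewrite mulrC /w -/q -!mulrA ler_wpM2l//; apply: le_trans h2 _.
  by rewrite -mulrA ler_wpM2l ?nH_ge0// [X in _ <= X]mulrA ler_wpM2r ?nH_ge0.
rewrite -mulr_suml -mulr_suml -/B ler_wpM2r ?nH_ge0//.
have B1 : 0 < B + 1 by lra.
by rewrite mulrC mulrAC ler_pdivrMr// ler_pM2l// lerDl.
Qed.

(** A rank one operator [theta x y] is bounded on tails by the norm of the tail of [y]; a
    compact operator is a small perturbation of a finite sum of these. *)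
Lemma compact_tail_small K (e : R) : compact_op K -> 0 < e ->
  exists n, forall z, HA z -> nH (K (tail n z)) <= e * nH z.
Proof.
move=> [BK Kapx] e0; have e2 : 0 < e / 2 by rewrite divr_gt0.
have [|S fS KS] := Kapx (e / 2)%:C; first by rewrite ltcR.
have [n Sn] := finite_rank_tail_small fS e2; exists n => z hz.
have htz := @HA_tail n _ hz.
have hS w : HA w -> HA (S w).
  case: fS => k [c [x [y [hxy SE]]]] hw; rewrite SE//; apply: HA_sum => i _.
  by apply: HAZ; apply: HA_rscale; case: (hxy i).
have := KS _ htz; rewrite !hnormE -rmorphM/= lecR => KSz.
have [mK _] := Ba_bmap BK; have hKS := HAB (map_HA mK htz) (hS _ htz).
rewrite -[K _](subrK (S (tail n z))).
apply: le_trans (nHD hKS (hS _ htz)) _.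
have := Sn _ hz; have := nH_tail_le n hz; nra.
Qed.

Lemma HA_finite_support n x : (forall i, (n <= i)%N -> x i = 0) -> HA x.
Proof.
move=> x0; apply/HA_cauchyP => e e0; exists n => k j nk kj.
rewrite /fnorm /fip big_nat big1 ?nA0 ?sqrtr0 ?ltW// => i /andP[ki _].
by rewrite x0 ?mulr0//; exact: leq_trans ki.
Qed.

Definition unit_seq k : nat -> A := fun i => if i == k then (1 : cring A) else 0.

Lemma HA_unit_seq k : HA (unit_seq k).
Proof.
apply: (@HA_finite_support k.+1) => i ki; rewrite /unit_seq.
by rewrite gtn_eqF.
Qed.

Lemma sum_unit_seq n x : \sum_(i < n) rscale (unit_seq i) (x i) = x - tail n x.
Proof.
apply/funext => j; rewrite fct_sumE /rscale /unit_seq /tail !fctE.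
have [jn|nj] := ltnP j n.
  rewrite subr0 (bigD1 (Ordinal jn))//= eqxx big1 ?addr0; first exact: (@mul1r (cring A) (x j)).
  move=> i /eqP ij; rewrite ifF; first exact: (@mul0r (cring A) (x i)).
  by apply/eqP => ji; apply: ij; exact/val_inj.
rewrite subrr big1// => i _; rewrite gtn_eqF; first exact: (@mul0r (cring A) (x i)).
exact: leq_trans nj.
Qed.

(** * From a left inverse modulo compacts to a Fredholm decomposition *)

(** Since [V F V = V], both [V F] and [F V] are idempotent, and [F] intertwines them.  The
    range of [V F] consists of the sequences vanishing before [n], so its kernel is the
    image of the span of the first [n] unit sequences under [1 - V F]. *)
Lemma Fredholm_of_generalized_inverse F V (n : nat) : Ba F -> bmap V ->
  (forall x, HA x -> V (F (tail n x)) = tail n x) ->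
  (forall y, HA y -> V y = tail n (V y)) -> upper_semi_Fredholm F.
Proof.
move=> BF bV VFt Vt; split => //; have bF := Ba_bmap BF.
have [mF _] := bF; have [mV _] := bV.
have VFV y : HA y -> V (F (V y)) = V y.
  by move=> hy; rewrite (Vt y hy) VFt//; exact: map_HA.
have bQ := bmap_comp bV bF; have bE := bmap_comp bF bV.
have hV y : HA y -> HA (V y) by exact: map_HA.
have hF y : HA y -> HA (F y) by exact: map_HA.
exists [set x | HA x /\ (V \o F) x = x], [set x | HA x /\ (V \o F) x = 0].
exists [set x | HA x /\ (F \o V) x = x], [set x | HA x /\ (F \o V) x = 0].
have dQ : direct_sum [set x | HA x /\ (V \o F) x = x] [set x | HA x /\ (V \o F) x = 0].
  by apply: idempotent_direct_sum => //= x hx; rewrite VFV//; exact: hF.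
split.
- split => //; apply: idempotent_direct_sum => //= x hx; rewrite VFV//.
- by move=> x [hx /= Qx]; split; [exact: hF|rewrite /= Qx].
- by move=> x [hx /= Qx]; split; [exact: hF|rewrite /= Qx (map0 mF)].
- split.
  + by move=> x y a [hx _] [hy _]; exact: (proj2 mF).
  + have [c c0 cF] := bmap_bound bF; apply/bounded_onP; exists c => // x [hx _].
    exact: cF.
  + split.
    * by move=> x [hx /= Qx]; split; [exact: hF|rewrite /= Qx].
    * move=> x y /set_mem[_ /= Qx] /set_mem[_ /= Qy] Fxy.
      by rewrite -Qx -Qy Fxy.
    * move=> y [hy /= Ey]; exists (V y) => //.
      by split; [exact: hV|rewrite /= VFV].
  + exists V; first by move=> x [].
    have [c c0 cV] := bmap_bound bV; apply/bounded_onP; exists c => // x [hx _].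
    exact: cV.
pose g (i : 'I_n) := unit_seq i - V (F (unit_seq i)).
have hu i := HA_unit_seq i.
have hVF x : HA x -> HA (V (F x)) by move=> /hF/hV.
exists n, g; apply/seteqP; split=> [x [hx /= Qx]|_ [a ->]].
  exists x.
  have {1}-> : x = (x - tail n x) - V (F (x - tail n x)).
    have htx := @HA_tail n _ hx.
    rewrite (mapB mF hx htx) (mapB mV (hF _ hx) (hF _ htx)) Qx VFt//.
    by rewrite sub0r opprK subrK.
  have hux i : HA (rscale (unit_seq i) (x i)) by exact: HA_rscale (hu i).
  rewrite -sum_unit_seq (map_sum mF)// (map_sum mV); last by move=> i; exact: hF.
  rewrite -sumrB; apply: eq_bigr => i _.
  have hui := hu i; rewrite (map_rscale mF (x i) hui) (map_rscale mV (x i) (hF _ hui)).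
  by rewrite rscaleBl.
have [_ cN _ _] := dQ; case: (cN) => _ N0 ND NZ _.
apply: (big_ind (fun x => [set x | HA x /\ (V \o F) x = 0] x)) => // i _.
apply: NZ; split; first exact: HAB (hu i) (hVF _ (hu i)).
have hVFu := hVF _ (hu i).
by rewrite /= (mapB mF (hu i) hVFu) (mapB mV (hF _ (hu i)) (hF _ hVFu)) (VFV _ (hF _ (hu i))) subrr.
Qed.

(** For [n] large, [W = 1 + K (tail n)] is a perturbation of the identity of norm at most
    one half, hence invertible, and [D F] agrees with [W] on sequences vanishing before
    [n].  So [tail n] after the inverse of [W] after [D] is a generalized inverse of [F]. *)
Lemma Fredholm_of_left_inverse F D K : Ba F -> Ba D -> compact_op K ->
  (forall x, HA x -> D (F x) = x + K x) -> upper_semi_Fredholm F.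
Proof.
move=> BF BD cK DF; have [mK _] := Ba_bmap (proj1 cK).
have half_gt0 : (0 : R) < 2^-1 by rewrite invr_gt0.
have [n Kn] := compact_tail_small cK half_gt0.
have bt := bmap_tail n; have [mt _] := bt.
pose W x := x + K (tail n x).
have hKt x : HA x -> HA (K (tail n x)) by move=> hx; exact/(map_HA mK)/HA_tail.
have mW : module_map W.
  split=> [x hx|x y a hx hy]; first by apply: HAD => //; exact: hKt.
  have [htx hty] := (@HA_tail n _ hx, @HA_tail n _ hy).
  rewrite /W (proj2 mt _ _ a hx hy) (proj2 mK _ _ a htx hty) rscaleDl.
  exact: addrACA.
have [|x hx|y hy|Wi [bWi _ WWi WiW]] := @bmap_inverse W 2 mW.
- exact: ler0n.
- rewrite /W; have hw := HAD hx (hKt _ hx).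
  have := nHB hw (hKt _ hx); rewrite addrK; have := Kn _ hx; lra.
- pose gy x := y - K (tail n x).
  have [||x [hx xE]] := @contraction_fixpoint _ _ gy.
  + by move=> x hx; apply: HAB => //; exact: hKt.
  + move=> x x' hx hx'; rewrite /gy opprB addrC addrA subrK.
    have [htx htx'] := (@HA_tail n _ hx, @HA_tail n _ hx').
    rewrite -(mapB mK htx' htx) -(mapB mt hx' hx).
    by apply: le_trans (Kn _ (HAB hx' hx)) _; rewrite nHC.
  + by exists x; split => //; rewrite /W -{1}xE /gy subrK.
apply: (@Fredholm_of_generalized_inverse _ (tail n \o (Wi \o D)) n) => //.
- by apply: bmap_comp => //; apply: bmap_comp => //; exact: Ba_bmap.
- move=> x hx /=; have htx := @HA_tail n _ hx.
  rewrite DF// -{2}[tail n x](tail_tail _ (leqnn n)) -/(W _) WiW//.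
  by rewrite tail_tail.
- by move=> y hy /=; rewrite tail_tail.
Qed.

End BoundedMaps.
(** * Adjoints, direct sums and finitely generated summands *)

Section Parametrix.
Context {R : realType} {A : cstarAlgType R}.
Implicit Types (x y z : nat -> A) (a b : cring A).
Local Notation op := ((nat -> A) -> (nat -> A)).
Implicit Types (F T S V D K E : op).
Local Notation I1 := (1 : cring A).

Lemma hinBl x y z : HA x -> HA y -> HA z -> hin (x - y) z = hin x z - hin y z.
Proof.
move=> hx hy hz; rewrite -(hin_star hz (HAB hx hy)) hinBr// starB.
by rewrite !hin_star.
Qed.

(** Linearity follows from nondegeneracy of the inner product, and the bound from the
    identity of the inner product of [S y] with itself and that of [T (S y)] with [y]. *)
Lemma adjoint_bmap T S : bmap T -> adjoint T S -> bmap S.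
Proof.
move=> bT [hS TS]; have [mT _] := bT; have [c c0 cT] := bmap_bound bT.
have TSin x y : HA x -> HA y -> hin (T x) y = hin x (S y) by exact: TS.
split; first split.
- exact: hS.
- move=> x y a hx hy; have [hSx hSy] := (hS _ hx, hS _ hy).
  have hxa := @HA_rscale _ _ _ a hx; have hSxa := @HA_rscale _ _ _ a hSx.
  apply/eqP; rewrite -subr_eq0; apply/eqP; apply: hin_eq0 => [|w hw].
    by apply: HAB; [exact/hS/HAD|exact: HAD].
  have hTw := map_HA mT hw.
  rewrite (hinBr hw (hS _ (HAD hxa hy)) (HAD hSxa hSy)).
  rewrite -(TSin _ _ hw (HAD hxa hy)) (hinDr hw hSxa hSy) (hinDr hTw hxa hy).
  by rewrite (hin_rscale a hw hSx) (hin_rscale a hTw hx) !TSin// subrr.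
apply/bounded_onP; exists c => // y hy; have hSy := hS _ hy.
have [->|Sy0] := eqVneq (nH (S y)) 0; first by rewrite mulr_ge0 ?nH_ge0.
have Sy_gt0 : 0 < nH (S y) by rewrite lt0r Sy0 nH_ge0.
rewrite -(ler_pM2l Sy_gt0) -expr2 nH2 -TSin//.
apply: le_trans (nA_hin_le (map_HA mT hSy) hy) _.
by rewrite mulrA ler_wpM2r ?nH_ge0// [X in _ <= X]mulrC cT.
Qed.

Lemma direct_sum_unique (M N : set (nat -> A)) m m' u u' : direct_sum M N ->
  M m -> M m' -> N u -> N u' -> m + u = m' + u' -> m = m' /\ u = u'.
Proof.
move=> [cM cN MN _] Mm Mm' Nu Nu' mu.
have mE : m - m' = u' - u.
  by apply/eqP; rewrite subr_eq addrAC eq_sym subr_eq mu addrC.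
have : (M `&` N) (m - m').
  by split; [exact: submodB|rewrite mE; exact: submodB].
rewrite MN => /= m0; split; apply/eqP; rewrite -subr_eq0; first by rewrite m0.
by rewrite -opprB -mE m0 oppr0.
Qed.

(** The projection onto [M] along [N] is bounded, by the open mapping theorem for
    addition. *)
Lemma direct_sum_bound (M N : set (nat -> A)) : direct_sum M N ->
  exists2 C : R, 0 < C & forall m u, M m -> N u -> nH m <= C * nH (m + u).
Proof.
move=> dMN; have [cM cN MN MNE] := dMN.
have [mid bid] := @bmap_id R A.
have [|C C0 CP] := sum_ball_open cM cN mid bid.
  move=> z; rewrite -MNE => -[m Mm [u Nu mu]]; by exists m, u.
exists C => // m u Mm Nu; apply: le_of_forall_eps => e e0.
have hmu : HA (m + u) by apply: HAD; [exact: submod_HA Mm|exact: submod_HA Nu].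
have eC : 0 < e / C by rewrite divr_gt0.
have s0 : 0 < nH (m + u) + e / C by rewrite ltr_wpDl ?nH_ge0.
have [|m' [u' [Mm' Nu' mu' mC _]]] := CP (m + u) _ hmu s0; first by rewrite lerDl ltW.
have [{1}-> _] := direct_sum_unique dMN Mm Mm' Nu Nu' mu'.
by rewrite mulrDr mulrCA divff ?gt_eqF// mulr1 in mC.
Qed.

Lemma closed_HA : closed_submodule (@HA R A).
Proof.
split; [by []|exact: HA0|by move=> x y; exact: HAD| |by move=> x hx _].
by move=> x a; exact: HA_rscale.
Qed.

Definition comb n (g : 'I_n -> nat -> A) x : nat -> A :=
  \sum_(i < n) rscale (g i) (x i).

Lemma bmap_comb n (g : 'I_n -> nat -> A) : (forall i, HA (g i)) -> bmap (comb g).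
Proof.
move=> hg; have hgx i a : HA (rscale (g i) a) by exact: HA_rscale (hg i).
split; first split.
- by move=> x _; exact: HA_sum.
- move=> x y a _ _; rewrite /comb.
  apply: (etrans (eq_bigr (fun i => rscale (rscale (g i) (x i)) a + rscale (g i) (y i)) _)).
    move=> i _; apply/funext => j; rewrite {1 3}/rscale !fctE [LHS](@mulrDr (cring A)).
    by congr (_ + _); exact: (@mulrA (cring A)).
  rewrite big_split; congr (_ + _); apply/funext => j.
  rewrite /rscale !fct_sumE; apply: esym; exact: (@big_distrl (cring A)).
apply/bounded_onP; exists (\sum_(i < n) nH (g i)); first by rewrite sumr_ge0// => i _; exact: nH_ge0.
move=> x hx; apply: le_trans (nH_sum _ _ (fun i => hgx i _)) _.
rewrite mulr_suml; apply: ler_sum => i _; apply: le_trans (nH_rscale _ (hg i)) _.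
by rewrite ler_wpM2l ?nH_ge0// nA_coord_le.
Qed.

(** By the open mapping theorem for the map [comb g], [x] is a combination of the generators
    with coefficients controlled by [nH x].  Substituting it into the inner product of
    [x] with itself gives the bound. *)
Lemma finitely_generated_bound (M N : set (nat -> A)) n (g : 'I_n -> nat -> A) :
  direct_sum M N ->
  N = [set x | exists a : 'I_n -> A, x = \sum_(i < n) rscale (g i) (a i)] ->
  (forall i, HA (g i)) ->
  exists2 C : R, 0 < C &
    forall x, N x -> nH x <= C * \sum_(i < n) nA (hin (g i) x).
Proof.
move=> dMN NE hg; have [cM cN MN MNE] := dMN.
have [mG bG] := bmap_comb hg.
have Ncomb x : N (comb g x) by rewrite NE; exists (fun i => x i).
have [|C C0 CP] := sum_ball_open cM closed_HA mG bG.
  move=> z hz.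
  have : [set x + y | x in M & y in N] z by rewrite MNE.
  move=> [m Mm [u]]; rewrite NE => -[a ->] mu.
  (* A tuple of coefficients is read as a sequence supported on [0 .. n - 1]. *)
  pose w : nat -> A := fun i => if insub i is Some j then a j else 0.
  have hw : HA w.
    apply: (HA_finite_support (n := n)) => i ni; rewrite /w insubF//.
    by rewrite ltnNge ni.
  exists m, w; split; [exact: Mm|exact: hw|].
  by rewrite -mu; congr (_ + _); apply: eq_bigr => i _; rewrite /w valK.
exists C => // x Nx; have hx := submod_HA cN Nx.
have [->|x0] := eqVneq (nH x) 0.
  by apply: mulr_ge0; [exact: ltW|apply: sumr_ge0 => i _; exact: nA_ge0].
have xgt0 : 0 < nH x by rewrite lt0r x0 nH_ge0.
have [m [u [Mm hu xE _ uC]]] := CP x _ hx xgt0 (lexx _).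
have [_ xE'] : 0 = m /\ x = comb g u.
  by apply: (direct_sum_unique dMN) => //; [case: cM|rewrite add0r].
have hgu i : HA (rscale (g i) (u i)) by exact: HA_rscale (hg i).
rewrite -(ler_pM2l xgt0) -expr2 nH2 {2}xE' hin_sumr//.
apply: le_trans (nA_sum _ _ _) _; rewrite mulrA mulr_sumr; apply: ler_sum => i _.
rewrite (hin_rscale (u i) hx (hg i)); apply: le_trans (nAM _ _) _.
rewrite -(hin_star (hg i) hx) nA_star mulrC ler_wpM2r ?nA_ge0//.
by rewrite [X in _ <= X]mulrC; apply: le_trans uC; exact: nA_coord_le.
Qed.

(** * The continuity method *)

(** [S + l] is surjective for large [l].  The lower bound, uniform in [l], makes surjectivity
    pass from [l] to all parameters at distance at most [(2 C)^-1], so [l = 0] is reached in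
    finitely many steps. *)
Lemma surjective_of_lower_bound S (C : R) : bmap S -> 0 < C ->
  (forall (l : R) x, 0 <= l -> HA x -> nH x <= C * nH (S x + l%:C *: x)) ->
  forall y, HA y -> exists x, HA x /\ S x = y.
Proof.
move=> bS C0 low; have [mS _] := bS; have [c c0 cS] := bmap_bound bS.
pose surj (l : R) := forall y, HA y -> exists x, HA x /\ S x + l%:C *: x = y.
have mSl (l : R) : module_map (fun x => S x + l%:C *: x).
  split=> [x hx|x y a hx hy]; first by apply: HAD; [exact: map_HA|exact: HAZ].
  rewrite (proj2 mS _ _ a hx hy) scalerDr rscaleDl addrACA; congr (_ + (_ + _)).
  by rewrite !scale_rscale !rscale_rscale rscaleAl rscaleAr mul1r mulr1.
have start : surj (2 * c + 1).
  move=> y hy; have l0 : 0 < 2 * c + 1 by lra.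
  have [||x [hx xE]] := @contraction_fixpoint _ A (fun x => ((2 * c + 1)^-1)%:C *: (y - S x)).
  - by move=> x hx; apply: HAZ; apply: HAB => //; exact: map_HA.
  - move=> x x' hx hx'; have [hSx hSx'] := (map_HA mS hx, map_HA mS hx').
    rewrite -scalerBr (_ : _ - (y - S x') = S x' - S x); last first.
      by rewrite opprB addrC addrA subrK.
    rewrite -(mapB mS hx' hx).
    apply: le_trans (nHZ _ (map_HA mS (HAB hx' hx))) _.
    rewrite gtr0_norm ?invr_gt0// ler_pdivrMl// nHC//.
    by have := cS _ (HAB hx' hx); have := nH_ge0 (x' - x); nra.
  exists x; split => //; rewrite -{2}xE scalerA -rmorphM/= divff ?gt_eqF//.
  by rewrite rmorph1 scale1r addrC subrK.
have step (l k : R) : 0 <= l -> `|l - k| <= (2 * C)^-1 -> surj l -> surj k.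
  move=> l0 lk sl.
  have [L [[mL _] LC SL _]] := bmap_inverse (mSl l) (ltW C0) (low l ^~ l0) sl.
  move=> y hy.
  have hyx x : HA x -> HA (y + (l - k)%:C *: x) by move=> hx; apply: HAD => //; exact: HAZ.
  have [||x [hx xE]] := @contraction_fixpoint _ A (fun x => L (y + (l - k)%:C *: x)).
  - by move=> x hx; apply: (map_HA mL); exact: hyx.
  - move=> x x' hx hx'; rewrite -(mapB mL (hyx _ hx) (hyx _ hx')).
    apply: le_trans (LC _ (HAB (hyx _ hx) (hyx _ hx'))) _.
    rewrite opprD addrACA subrr add0r -scalerBr.
    apply: le_trans (ler_wpM2l (ltW C0) (nHZ _ (HAB hx hx'))) _.
    rewrite mulrA ler_wpM2r ?nH_ge0//.
    apply: le_trans (ler_wpM2l (ltW C0) lk) _.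
    by rewrite invfM mulrCA divff ?gt_eqF// mulr1.
  exists x; split => //; have := SL _ (hyx _ hx); rewrite xE => SxE.
  apply: (@addIr _ ((l - k)%:C *: x)); rewrite -SxE -addrA -scalerDl -rmorphD/=.
  by rewrite [k + _]addrC subrK.
(* Walk down from the starting parameter in steps of length [(2 C)^-1], stopping at [0]. *)
have all k : surj (Num.max 0 (2 * c + 1 - k%:R * (2 * C)^-1)).
  have d0 : 0 < (2 * C)^-1 by rewrite invr_gt0 mulr_gt0.
  elim: k => [|k IH]; first by rewrite mul0r subr0 max_r//; lra.
  apply: step IH; first by rewrite le_max lexx.
  set d := (2 * C)^-1 in d0 *; set w := 2 * c + 1 - k%:R * d.
  have -> : 2 * c + 1 - k.+1%:R * d = w - d by rewrite /w -(natr1 k); ring.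
  rewrite /Num.max; case: ifP; case: ifP => h1 h2; rewrite ler_norml; lra.
move=> y hy; pose k := Num.bound ((2 * c + 1) * (2 * C)).
have [x [hx xE]] := all k y hy; exists x; split => //.
rewrite -xE max_l ?rmorph0 ?scale0r ?addr0//.
have C2 : 0 < 2 * C by rewrite mulr_gt0.
rewrite subr_le0 ler_pdivlMr//; apply/ltW/archi_boundP.
by rewrite mulr_ge0 ?ltW//; lra.
Qed.

End Parametrix.
(** * From a Fredholm decomposition to a left inverse modulo compacts *)

Section Main.
Context {R : realType} {A : cstarAlgType R}.
Implicit Types (x y z : nat -> A) (a b : cring A).
Local Notation op := ((nat -> A) -> (nat -> A)).
Implicit Types (F T S V D K E : op).

Lemma finitely_generated_gens (N : set (nat -> A)) n (g : 'I_n -> nat -> A) i :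
  N = [set x | exists a : 'I_n -> A, x = \sum_(i < n) rscale (g i) (a i)] ->
  N (g i).
Proof.
move=> ->; exists (fun j => if j == i then (1 : cring A) else 0).
rewrite (bigD1 i)//= eqxx big1 ?addr0; first by rewrite rscale1.
move=> j /negbTE ->; apply/funext => k; exact: (@mulr0 (cring A)).
Qed.

Lemma pos_hin x : HA x -> pos (hin x x).
Proof.
move=> hx; split; first exact: hin_star.
exists (nH x ^+ 2); first exact: sqr_ge0.
rewrite nAC; apply: (tends_nA_le (tends_hinner hx hx)).
exists 0%N => n _; rewrite nAC; apply: pos_dist; first exact: pos_fip.
by rewrite -fnorm2 ler_pXn2r// ?nnegrE ?fnorm_ge0 ?nH_ge0// fnorm_le_nH.
Qed.

(** Split [x = m + u] along the first decomposition.  The component [m] is controlled by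
    [F m], hence by [F x] because the projection onto [M2] is bounded; the component [u] is
    controlled by its inner products with the generators of [N1]. *)
Lemma Fredholm_lower_bound F : upper_semi_Fredholm F ->
  exists n (g : 'I_n -> nat -> A), (forall i, HA (g i)) /\
    exists2 C : R, 0 < C & forall x, HA x ->
      nH x <= C * (nH (F x) + \sum_(i < n) nA (hin (g i) x)).
Proof.
move=> [BF [M1 [N1 [M2 [N2 [[d1 d2] FM FN [_ _ _ [S SF bS]] [n [g N1E]]]]]]]].
have [mF _] := Ba_bmap BF; have [c1 c1' M1N1 M1N1E] := d1.
have hg i : HA (g i) by exact: submod_HA c1' (finitely_generated_gens i N1E).
exists n, g; split => //.
have [C1 C10 C1P] := direct_sum_bound d2.
have [C2 C20 C2P] := finitely_generated_bound d1 N1E hg.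
have /bounded_onP[c c0 cS] := bS.
pose G := \sum_(i < n) nH (g i).
have G0 : 0 <= G by apply: sumr_ge0 => i _; exact: nH_ge0.
pose B := (1 + C2 * G) * (c * C1).
have B0 : 0 <= B.
  by rewrite mulr_ge0 ?mulr_ge0 ?addr_ge0// ?mulr_ge0// ltW.
exists (B + C2); first by rewrite ltr_wpDl.
move=> x hx; have : [set x + y | x in M1 & y in N1] x by rewrite M1N1E.
move=> [m Mm [u Nu muE]]; have [hm hu] := (submod_HA c1 Mm, submod_HA c1' Nu).
have mle : nH m <= c * C1 * nH (F x).
  rewrite -{1}(SF _ Mm); apply: le_trans (cS _ (FM _ Mm)) _.
  by rewrite -mulrA ler_wpM2l// -muE (mapD mF hm hu) C1P//; [exact: FM|exact: FN].
pose s := \sum_(i < n) nA (hin (g i) x).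
have s0 : 0 <= s by apply: sumr_ge0 => i _; exact: nA_ge0.
have ule : nH u <= C2 * (s + G * nH m).
  apply: le_trans (C2P _ Nu) _; rewrite ler_pM2l// mulr_suml -big_split/=.
  apply: ler_sum => i _; have := nA_hin_le (hg i) hm.
  have := nAB (hin (g i) x) (hin (g i) m).
  by rewrite -hinBr// -{1}muE addrAC subrr add0r; lra.
rewrite -/s; have xle : nH x <= nH m + nH u by rewrite -muE nHD.
have Fx0 := nH_ge0 (F x); have m0 := nH_ge0 m.
have h1 : (1 + C2 * G) * nH m <= B * nH (F x).
  by rewrite -mulrA ler_wpM2l// addr_ge0// mulr_ge0// ltW.
apply: le_trans xle _; rewrite mulrDl !mulrDr.
have : 0 <= B * s by rewrite mulr_ge0.
have : 0 <= C2 * nH (F x) by rewrite mulr_ge0// ltW.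
move: ule h1; rewrite mulrDr mulrDl mul1r mulrA; lra.
Qed.

(** The positive operator [G G^*] for the map [G] sending a tuple [a] in [A^n] to the sum of
    the [g i a i]. *)
Definition gram n (g : 'I_n -> nat -> A) x : nat -> A :=
  \sum_(i < n) theta (g i) (g i) x.

Lemma bmap_theta x y : HA x -> HA y -> bmap (theta x y).
Proof.
move=> hx hy; split; first split.
- by move=> z hz; exact: HA_rscale hx.
- move=> z w a hz hw; have hza := @HA_rscale _ _ _ a hz.
  rewrite /theta -!/(hin _ _) hinDr// hin_rscale// rscale_rscale.
  by apply/funext => i; exact: (@mulrDr (cring A)).
apply/bounded_onP; exists (nH x * nH y); first by rewrite mulr_ge0 ?nH_ge0.
move=> z hz; apply: le_trans (nH_rscale _ hx) _.
by rewrite -mulrA ler_wpM2l ?nH_ge0// nA_hin_le.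
Qed.

Lemma bmap_add S T : bmap S -> bmap T -> bmap (fun x => S x + T x).
Proof.
move=> bS bT; have [mS _] := bS; have [mT _] := bT; split; first split.
- by move=> x hx; apply: HAD; exact: map_HA.
- move=> x y a hx hy; rewrite (proj2 mS _ _ a hx hy) (proj2 mT _ _ a hx hy).
  by rewrite rscaleDl; exact: addrACA.
have [c c0 cS] := bmap_bound bS; have [d d0 dT] := bmap_bound bT.
apply/bounded_onP; exists (c + d); first exact: addr_ge0.
move=> x hx; apply: le_trans (nHD (map_HA mS hx) (map_HA mT hx)) _.
by rewrite mulrDl; apply: lerD; [exact: cS|exact: dT].
Qed.

Lemma bmap_gram n (g : 'I_n -> nat -> A) : (forall i, HA (g i)) -> bmap (gram g).
Proof.
move=> hg.
rewrite (_ : gram g = \sum_(i < n) theta (g i) (g i)); last first.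
  by apply/funext => x; rewrite fct_sumE.
apply: (big_ind bmap); first exact: bmap_cst0.
  by move=> S T; exact: bmap_add.
by move=> i _; exact: bmap_theta.
Qed.

Lemma hin_gram n (g : 'I_n -> nat -> A) x y :
  (forall i, HA (g i)) -> HA x -> HA y ->
  hin x (gram g y) = \sum_(i < n) star (hin (g i) x) * hin (g i) y.
Proof.
move=> hg hx hy; have hth i : HA (theta (g i) (g i) y) by exact: HA_rscale (hg i).
rewrite (hin_sumr _ _ hx hth); apply: eq_bigr => i _; rewrite /theta -!/(hin _ _).
by rewrite (hin_rscale _ hx (hg i)) hin_star.
Qed.

Lemma gram_sym n (g : 'I_n -> nat -> A) x y :
  (forall i, HA (g i)) -> HA x -> HA y ->
  hin (gram g x) y = hin x (gram g y).
Proof.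
move=> hg hx hy; rewrite -hin_star//; last exact: (map_HA (proj1 (bmap_gram hg))).
rewrite !hin_gram// star_sum; apply: eq_bigr => i _.
by rewrite starM starK.
Qed.

(** The operator [S = F^* F + gram g] is symmetric, and [Fredholm_lower_bound] makes it
    bounded below, uniformly after adding a nonnegative scalar; hence it is invertible.  Then [D = S^-1 F^*] satisfies [D F = 1 - S^-1 (gram g)], and the
    last term has finite rank. *)
Lemma left_inverse_of_Fredholm F : upper_semi_Fredholm F ->
  exists D K : op, [/\ Ba D, compact_op K
    & forall x, HA x -> D (F x) = x + K x].
Proof.
move=> FF; have [BF _] := FF; have bF := Ba_bmap BF.
have [n [g [hg [C C0 low]]]] := Fredholm_lower_bound FF.
have [_ _ _ [Fs FsP]] := BF; have bFs := adjoint_bmap bF FsP.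
have FsE x y : HA x -> HA y -> hin (F x) y = hin x (Fs y) by exact: (proj2 FsP).
have [[mF _] [mFs _]] := (bF, bFs).
have bG := bmap_gram hg; have [mG _] := bG.
pose S x := Fs (F x) + gram g x.
have bS : bmap S by apply: bmap_add => //; exact: bmap_comp.
have [mS _] := bS.
have hF x : HA x -> HA (F x) by exact: map_HA.
have hFs x : HA x -> HA (Fs x) by exact: map_HA.
have hG x : HA x -> HA (gram g x) by exact: map_HA.
have Ssym x y : HA x -> HA y -> hin (S x) y = hin x (S y).
  move=> hx hy; have [hFx hFy] := (hF _ hx, hF _ hy).
  rewrite /S (hinDl (hFs _ hFx) (hG _ hx) hy) (hinDr hx (hFs _ hFy) (hG _ hy)).
  rewrite (gram_sym hg hx hy) -(FsE _ _ hx hFy) -(hin_star hy (hFs _ hFx)).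
  by rewrite -(FsE _ _ hy hFx) (hin_star hFy hFx).
(* [1 + n] counts the norms bounded by [Num.sqrt q] below. *)
pose k : R := 1 + n%:R.
have k0 : 0 < k by rewrite ltr_wpDr.
have Slow (l : R) x : 0 <= l -> HA x ->
    nH x <= (C * k) ^+ 2 * nH (S x + l%:C *: x).
  move=> l0 hx; set w := S x + _.
  have hSx : HA (S x) by exact: map_HA.
  have hw : HA w by apply: HAD => //; exact: HAZ.
  pose q := nA (hin x w).
  have wE : hin x w = hin (F x) (F x) +
      \sum_(i < n) star (hin (g i) x) * hin (g i) x + l *: hin x x.
    have hFx := hF _ hx; rewrite /w (hinDr hx hSx (HAZ hx)).
    rewrite scale_rscale (hin_rscale _ hx hx) rscaleAr mulr1; congr (_ + _).
    by rewrite (hinDr hx (hFs _ hFx) (hG _ hx)) (hin_gram hg hx hx) -(FsE _ _ hx hFx).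
  have pF := pos_hin (hF _ hx); have px := pos_hin hx.
  have pG : pos (\sum_(i < n) star (hin (g i) x) * hin (g i) x).
    apply: (big_ind (@pos _ _)); [exact: pos0|by move=> ? ?; exact: posD|].
    by move=> i _; exact: pos_star_mul.
  have plx : pos (l *: hin x x) by exact: posZ.
  have Fq : nH (F x) <= Num.sqrt q.
    rewrite ler_sqrt ?nA_ge0// /q wE -addrA; apply: nA_mono => //; exact: posD.
  have gq i : nA (hin (g i) x) <= Num.sqrt q.
    rewrite -[X in X <= _]ger0_norm ?nA_ge0// -sqrtr_sqr ler_sqrt ?nA_ge0//.
    rewrite -nA_cstar /q wE (bigD1 i)//= -addrA addrCA -addrA.
    apply: nA_mono; first exact: pos_star_mul.
    apply: posD; last exact: posD.
    apply: (big_ind (@pos _ _)); [exact: pos0|by move=> ? ?; exact: posD|].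
    by move=> j _; exact: pos_star_mul.
  have xq : nH x <= C * k * Num.sqrt q.
    apply: le_trans (low _ hx) _; rewrite -mulrA ler_pM2l// mulrDl mul1r lerD//.
    apply: le_trans (ler_sum _ (fun i _ => gq i)) _.
    by rewrite sumr_const card_ord mulr_natl.
  have [->|x0] := eqVneq (nH x) 0; first by rewrite mulr_ge0 ?sqr_ge0 ?nH_ge0.
  have xgt0 : 0 < nH x by rewrite lt0r x0 nH_ge0.
  rewrite -(ler_pM2l xgt0) -expr2.
  apply: le_trans (_ : (C * k * Num.sqrt q) ^+ 2 <= _).
    rewrite ler_pXn2r// ?nnegrE ?nH_ge0//.
    exact: le_trans (nH_ge0 x) xq.
  rewrite exprMn sqr_sqrtr ?nA_ge0// mulrCA ler_wpM2l ?sqr_ge0//.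
  exact: nA_hin_le.
have Ck0 : 0 < (C * k) ^+ 2 by rewrite exprn_gt0// mulr_gt0.
have Ssurj := surjective_of_lower_bound bS Ck0 Slow.
have Slow0 x : HA x -> nH x <= (C * k) ^+ 2 * nH (S x).
  by move=> hx; have := Slow 0 x (lexx _) hx; rewrite rmorph0 scale0r addr0.
have [Si [bSi _ SSi SiS]] := bmap_inverse mS (ltW Ck0) Slow0 Ssurj.
have [mSi _] := bSi; have hSi x : HA x -> HA (Si x) by exact: map_HA.
have Sisym x y : HA x -> HA y -> hin (Si x) y = hin x (Si y).
  move=> hx hy; rewrite -{1}(SSi y hy) -(Ssym _ _ (hSi _ hx) (hSi _ hy)).
  by rewrite (SSi _ hx).
pose D x := Si (Fs x); pose K x := D (F x) - x.
have bD : bmap D by exact: bmap_comp.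
have DP x y : HA x -> HA y -> hin (D x) y = hin x (F (Si y)).
  move=> hx hy; have hy' := hSi _ hy; rewrite /D (Sisym _ _ (hFs _ hx) hy).
  by rewrite -(hin_star hy' (hFs _ hx)) -(FsE _ _ hy' hx) (hin_star (hF _ hy') hx).
have BD : Ba D.
  have [[? ?] ?] := bD; split => //; exists (F \o Si); split.
    by move=> x hx; exact/hF/hSi.
  exact: DP.
exists D, K; split => //; last by move=> x hx; rewrite /K addrC subrK.
have hD x : HA x -> HA (D x) by move=> hx; exact/hSi/hFs.
have bK : bmap K.
  have bDF := bmap_comp bD bF; have [mDF _] := bDF.
  have bN : bmap (fun x => - x).
    split; first split.
    - by move=> x; exact: HAN.
    - by move=> x y a _ _; rewrite opprD -!rscaleN1 !rscale_rscale mulrN1 mulN1r.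
    by apply/bounded_onP; exists 1 => // x hx; rewrite nHN// mul1r.
  exact: bmap_add.
have KE x : HA x -> K x = \sum_(i < n) (-1 : R[i]) *: theta (Si (g i)) (g i) x.
  move=> hx; have -> : K x = - Si (gram g x).
    have := SiS _ hx; rewrite /S (mapD mSi (hFs _ (hF _ hx)) (hG _ hx)) => xE.
    by rewrite /K -[X in _ - X]xE /D opprD addrA subrr sub0r.
  rewrite (map_sum mSi); last by move=> i; exact: HA_rscale (hg i).
  rewrite -sumrN; apply: eq_bigr => i _; rewrite scaleN1r.
  by rewrite /theta (map_rscale mSi _ (hg i)).
split.
  have [[? ?] ?] := bK; split => //.
  exists (fun x => Fs (F (Si x)) - x); split.
    by move=> x hx; apply: HAB => //; exact/hFs/hF/hSi.
  move=> x y hx hy; have hDFx := hD _ (hF _ hx); have hw := hF _ (hSi _ hy).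
  rewrite -!/(hin _ _) (hinBl hDFx hx hy) (hinBr hx (hFs _ hw) hy).
  by rewrite DP ?FsE//; exact: hF.
move=> e e0; exists K.
  exists n, (fun=> -1), (fun i => Si (g i)), g; split; last exact: KE.
  by move=> i; split; [exact: hSi|].
move=> x hx; rewrite subrr !hnormE nH0; apply: mulr_ge0; first exact: ltW.
by rewrite ler0c nH_ge0.
Qed.

End Main.

Theorem theorem2p2 (R : realType) (A : cstarAlgType R)
    (F : (nat -> A) -> (nat -> A)) (hF : Ba F) :
  upper_semi_Fredholm F <->
  exists D K : (nat -> A) -> (nat -> A),
    [/\ Ba D, compact_op K
      & forall x : nat -> A, HA x -> D (F x) = x + K x].
Proof.
split; first exact: left_inverse_of_Fredholm.
by move=> [D [K [BD cK DF]]]; exact: Fredholm_of_left_inverse hF BD cK DF.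
Qed.
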